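(* Let $K_1$ and $K_2$ be long virtual knots that commute, i.e. $K_1\cdot K_2=K_2\cdot K_1$. Then the following two equalities hold in $\mathbb{Z}[s^{\pm1}]$: $$W_{K_1}(s)\cdot W_{K_2}(s^{-1})=W_{K_1}(s^{-1})\cdot W_{K_2}(s),$$ $$W_{\mathrm{EO}(K_1)}(s)\cdot W_{\mathrm{EO}(K_2)}(s^{-1})=W_{\mathrm{EO}(K_1)}(s^{-1})\cdot W_{\mathrm{EO}(K_2)}(s).$$
   Context: Long virtual knots. A long virtual knot diagram is a smooth immersion $\phi:\mathbb{R}\to\mathbb{R}^2$ with $\phi(x)=(x,0)$ for $|x|$ large, all of whose self-intersections are transverse double points, each endowed with either a classical crossing structure (a choice of over- and underpass) or a virtual crossing structure. It is oriented by the standard orientation of $\mathbb{R}$. A long virtual knot is an equivalence class of such diagrams under (planar isotopy and) the generalized Reidemeister moves: the classical moves I, II, III; their virtual analogues, with all crossings virtual; and the mixed move, in which an arc all of whose crossings in the local picture are virtual is moved across a classical crossing. The product $K_1\cdot K_2$ is the class of the diagram obtained by concatenating a diagram of $K_1$ followed by one of $K_2$. A classical crossing $c$ is positive ($\epsilon(c)=+1$) if (direction of overstrand, direction of understrand) is a positively oriented basis of $\mathbb{R}^2$, and negative ($\epsilon(c)=-1$) otherwise. Travelling along $D$ from $-\infty$ to $+\infty$, $c$ is an EO (early overarc) crossing if it is first reached along its overarc, and an EU (early underarc) crossing if it is first reached along its underarc. Index. Give the overpass point of each classical crossing $c$ (a point of $\mathbb{R}$) the sign $\epsilon(c)$ and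 the underpass point the sign $-\epsilon(c)$. The index $\alpha(c)$ is the sum of the signs of all over-/underpass points of classical crossings lying strictly between the two points of $c$ in $\mathbb{R}$. For a long virtual knot $K$ with diagram $D$, $$W_K(s)=\sum_{c\in \mathrm{EO}}\epsilon(c)(s^{\alpha(c)}-1)+\sum_{d\in \mathrm{EU}}\epsilon(d)(s^{-\alpha(d)}-1)\in\mathbb{Z}[s^{\pm1}],$$ which is independent of the choice of $D$. $\mathrm{EO}(D)$ denotes the diagram obtained from $D$ by a crossing change (exchanging over and under) at each EU crossing; $\mathrm{EO}(K)$ is the long virtual knot represented by $\mathrm{EO}(D)$, which depends only on $K$. *)

(* Defs.v *)
From HB Require Import structures.
From mathcomp Require Import all_boot all_order all_algebra.
From mathcomp Require Import all_classical all_reals all_analysis.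
From mathcomp Require Import generic_quotient fraction lra.
From Stdlib Require Import Relations.Relation_Operators.

Set Implicit Arguments.
Unset Strict Implicit.
Unset Printing Implicit Defensive.

Import Order.TTheory GRing.Theory Num.Theory.
Import numFieldNormedType.Exports.

Local Open Scope classical_set_scope.
Local Open Scope ring_scope.

(* [V] is meant to be finite dimensional: there this is the usual notion of a
   C^n, resp. C^infinity, map. *)
Fixpoint Ck (R : realType) (V W : normedModType R) (n : nat) (f : V -> W) :
    Prop :=
  if n is m.+1 then
    (forall x, differentiable f x) /\ (forall v, Ck m (fun x => 'D_v f x))
  else continuous f.

Definition smooth (R : realType) (V W : normedModType R) (f : V -> W) : Prop :=
  forall n, Ck n f.

Definition det2 (R : realType) (v w : R * R) : R := v.1 * w.2 - v.2 * w.1.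

(* A double point is a pair of distinct parameters with the same image.  The
   crossing structure is the set [over]: [over (o, u)] says that the double
   point (o, u) is a classical crossing with overpass point [o] and underpass
   point [u].  A double point (s, t) with neither (s, t) nor (t, s) in [over]
   is a virtual crossing.  Thus [over] is also the set of classical
   crossings. *)
Record diagram (R : realType) := Diagram {
  curve :> R -> R * R;
  over : set (R * R);
  curve_smooth : smooth curve;
  curve_immersion : forall t, 'D_1 curve t != 0;
  curve_long : exists M : R, forall t : R, M <= `|t| -> curve t = (t, 0);
  curve_transverse : forall s t, s != t -> curve s = curve t ->
    det2 ('D_1 curve s) ('D_1 curve t) != 0;
  curve_double : forall r s t, curve r = curve s -> curve s = curve t ->
    r = s \/ s = t \/ r = t;
  over_double : forall o u, over (o, u) -> o != u /\ curve o = curve u;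
  over_asym : forall o u, over (o, u) -> ~ over (u, o) }.

Section Invariants.
Variables (R : realType) (D : diagram R).

Definition writhe (c : R * R) : int :=
  sgz (det2 ('D_1 D c.1) ('D_1 D c.2)).

Definition is_EO (c : R * R) : bool := c.1 < c.2.

Definition between (c : R * R) (t : R) : bool :=
  (Num.min c.1 c.2 < t) && (t < Num.max c.1 c.2).

(* The finitely supported sums below are over a finite set: [D] has finitely
   many double points, being transverse and standard outside a compact set. *)
Definition index (c : R * R) : int :=
  \sum_(d \in over D)
    (writhe d * (between c d.1)%:R - writhe d * (between c d.2)%:R).

(* The value W_D(x), for x a unit of a commutative ring (here, a field). *)
Definition diagram_W (F : fieldType) (x : F) : F :=
  \sum_(c \in over D)
    (writhe c)%:~R * (x ^ (if is_EO c then index c else - index c) - 1).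

End Invariants.

Section EarlyOver.
Variables (R : realType) (D : diagram R).

Definition EO_over : set (R * R) :=
  [set c | (over D c /\ is_EO c) \/ (over D (c.2, c.1) /\ ~~ is_EO (c.2, c.1))].

Lemma EO_over_double o u : EO_over (o, u) -> o != u /\ D o = D u.
Proof.
case=> -[/= /over_double[ne e] _]; first by [].
by rewrite eq_sym.
Qed.

Lemma EO_over_asym o u : EO_over (o, u) -> ~ EO_over (u, o).
Proof.
have lt_EO a b : EO_over (a, b) -> a < b.
  case=> -[/= ov]; rewrite /is_EO //= -leNgt le_eqVlt => /orP[/eqP e|//].
  by have [/eqP] := over_double ov; rewrite e.
by move=> /lt_EO ou /lt_EO uo; have := lt_trans ou uo; rewrite ltxx.
Qed.

Definition diagram_EO : diagram R :=
  Diagram (@curve_smooth R D) (@curve_immersion R D) (@curve_long R D)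
    (@curve_transverse R D) (@curve_double R D) EO_over_double EO_over_asym.

End EarlyOver.

Section Smoothness.
Variables (R : realType) (W : normedModType R).
Implicit Types f g : R -> W.

Lemma Ck_local n f :
  (forall x : R, exists g, Ck n g /\ \forall y \near x, f y = g y) -> Ck n f.
Proof.
elim: n f => [|n IH] f fg /=.
  move=> x; have [g [gc e]] := fg x.
  rewrite /continuous_at (nbhs_singleton e).
  apply: cvg_trans (gc x); apply: near_eq_cvg.
  by near=> y; apply/esym; near: y.
split=> [x|v].
  have [g [[gd _] e]] := fg x.
  apply/derivable1_diffP/(near_eq_derivable (f := g)); last first.
    exact/derivable1_diffP.
  by near=> y; apply/esym; near: y.
apply: IH => x; have [g [[_ gv] e]] := fg x.
exists (fun y => 'D_v g y); split; first exact: gv.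
have := near_join e; apply: filterS => y ey.
exact: near_eq_derive.
Unshelve. all: by end_near. Qed.

Lemma shift_growth_rate f (a : R) (c : W) (x v : R) :
  (fun h : R => h^-1 *: ((f (h *: v + x + a) + c) - (f (x + a) + c))) =
  (fun h : R => h^-1 *: (f (h *: v + (x + a)) - f (x + a))).
Proof. by apply/funext => h; rewrite addrA opprD addrACA subrr addr0. Qed.

Lemma shift_derivable f (a : R) (c : W) (x v : R) :
  derivable f (x + a) v -> derivable (fun t => f (t + a) + c) x v.
Proof. by rewrite /derivable /= shift_growth_rate. Qed.

Lemma shift_derive f (a : R) (c : W) (x v : R) :
  'D_v (fun t => f (t + a) + c) x = 'D_v f (x + a).
Proof. by rewrite /derive /= shift_growth_rate. Qed.

Lemma Ck_shift n f (a : R) (c : W) :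
  Ck n f -> Ck n (fun t => f (t + a) + c).
Proof.
elim: n f c => [|n IH] f c /=.
  move=> fc x; apply: cvgD; last exact: cvg_cst.
  apply: (@continuous_comp _ _ _ (fun t : R => t + a) f x); last exact: fc.
  by apply: cvgD; [exact: cvg_id|exact: cvg_cst].
case=> fd fv; split=> [x|v].
  by apply/derivable1_diffP/shift_derivable/derivable1_diffP.
under eq_fun do rewrite shift_derive.
have -> : (fun x => 'D_v f (x + a)) = (fun x => 'D_v f (x + a) + 0).
  by apply/funext => x; rewrite addr0.
exact: (IH ('D_v f) 0 (fv v)).
Qed.

End Smoothness.

Section Product.
Variables (R : realType).
Implicit Types D : diagram R.

Lemma curve_continuous D : continuous D.
Proof. exact: (curve_smooth D 0). Qed.

(* Outside the parameter interval ]-r, r[ the diagram is standard, with a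
   collar; inside, it stays in the vertical strip |x| < r. *)
Definition is_radius D (r : R) : Prop :=
  [/\ 1 <= r, forall t, r - 1 <= `|t| -> D t = (t, 0)
    & forall t, `|t| < r -> `|(D t).1| < r].

Lemma exists_radius D : exists r, is_radius D r.
Proof.
have [M DM] := curve_long D.
have ct : {within `[- (`|M| + 1), `|M| + 1], continuous (fun t => `|(D t).1|)}.
  apply: continuous_subspaceT => t.
  apply: (@continuous_comp _ _ _ (fun t => (D t).1) (fun x : R => `|x|) t);
    last exact: norm_continuous.
  apply: (@continuous_comp _ _ _ (D : R -> R * R) fst); last exact: cvg_fst.
  exact: curve_continuous.
have [|c _ cM] := EVT_max _ ct; first by rewrite ge0_cp// ?addr_ge0.
pose B := `|(D c).1|.
have B0 : 0 <= B by exact: normr_ge0.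
have M0 : 0 <= `|M| by exact: normr_ge0.
have leM := ler_norm M.
exists (`|M| + 1 + B + 1); split; first by lra.
  by move=> t Bt; apply: DM; lra.
move=> t tr; have [tM|Mt] := leP `|t| (`|M| + 1).
  have := cM t; rewrite in_itv /= -ler_norml tM => /(_ isT); rewrite -/B; lra.
by rewrite DM //=; lra.
Qed.

Definition radius D : R := sval (cid (exists_radius D)).

Lemma radiusP D : is_radius D (radius D).
Proof. exact: svalP (cid (exists_radius D)). Qed.

Variables D1 D2 : diagram R.

Let r1 := radius D1.
Let r2 := radius D2.

Definition left_curve (t : R) : R * R := D1 (t + r1) + (- r1, 0).
Definition right_curve (t : R) : R * R := D2 (t - r2) + (r2, 0).

Definition product_curve (t : R) : R * R :=
  if t < 0 then left_curve t else right_curve t.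

Definition product_over : set (R * R) :=
  [set c | [/\ c.1 < 0, c.2 < 0 & over D1 (c.1 + r1, c.2 + r1)] \/
           [/\ 0 <= c.1, 0 <= c.2 & over D2 (c.1 - r2, c.2 - r2)]].

Lemma product_left_std t : -1 <= t -> left_curve t = (t, 0).
Proof.
case: (radiusP D1); rewrite -/r1 => r1_ge1 std _ t1; rewrite /left_curve std.
  by congr pair; rewrite /= ?addr0// addrK.
by rewrite ger0_norm; lra.
Qed.

Lemma product_right_std t : t <= 1 -> right_curve t = (t, 0).
Proof.
case: (radiusP D2); rewrite -/r2 => r2_ge1 std _ t1; rewrite /right_curve std.
  by congr pair; rewrite /= ?addr0// subrK.
by rewrite ler0_norm; lra.
Qed.

Lemma product_left_near (t : R) : t < 0 -> \forall x \near t, product_curve x = left_curve x.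
Proof.
move=> t0; near=> x; rewrite /product_curve ifT//.
by near: x; exact: lt_nbhsl.
Unshelve. all: by end_near. Qed.

Lemma product_right_near (t : R) :
  0 <= t -> \forall x \near t, product_curve x = right_curve x.
Proof.
move=> t0; near=> x; rewrite /product_curve; case: ltP => // x0.
have x1 : -1 < x by near: x; apply: lt_nbhsr; lra.
by rewrite product_left_std ?product_right_std//; lra.
Unshelve. all: by end_near. Qed.

Lemma product_smooth : smooth product_curve.
Proof.
move=> n; apply: Ck_local => x; have [x0|x0] := ltP x 0.
  by exists left_curve; split; [exact/Ck_shift/curve_smooth|exact: product_left_near].
by exists right_curve; split; [exact/Ck_shift/curve_smooth|exact: product_right_near].
Qed.

Lemma product_left_derive t : t < 0 -> 'D_1 product_curve t = 'D_1 D1 (t + r1).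
Proof. by move=> t0; rewrite (near_eq_derive _ (product_left_near t0)) shift_derive. Qed.

Lemma product_right_derive t : 0 <= t -> 'D_1 product_curve t = 'D_1 D2 (t - r2).
Proof. by move=> t0; rewrite (near_eq_derive _ (product_right_near t0)) shift_derive. Qed.

Lemma product_left_val t : t < 0 -> product_curve t = left_curve t.
Proof. by rewrite /product_curve => ->. Qed.

Lemma product_right_val t : 0 <= t -> product_curve t = right_curve t.
Proof. by rewrite /product_curve leNgt => /negPf ->. Qed.

Lemma product_sign t : (product_curve t).1 < 0 = (t < 0).
Proof.
have [t0|t0] := ltP t 0.
  rewrite product_left_val//; have [t1|t1] := leP (-1) t; first by rewrite product_left_std.
  case: (radiusP D1); rewrite -/r1 => r1_ge1 std strip.
  have [tr|rt] := ltP `|t + r1| r1.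
    by have := strip _ tr; rewrite /left_curve /= ltr_norml => /andP[_]; lra.
  by rewrite /left_curve std /=; lra.
rewrite product_right_val//; have [t1|t1] := leP t 1.
  by rewrite product_right_std//=; apply/negbTE; rewrite -leNgt.
case: (radiusP D2); rewrite -/r2 => r2_ge1 std strip.
apply/negbTE; rewrite -leNgt.
have [tr|rt] := ltP `|t - r2| r2.
  by have := strip _ tr; rewrite /right_curve /= ltr_norml => /andP[+ _]; lra.
by rewrite /right_curve std /=; lra.
Qed.

Lemma product_same_side s t : product_curve s = product_curve t -> (s < 0) = (t < 0).
Proof. by move=> e; rewrite -(product_sign s) -(product_sign t) e. Qed.

Let left_inj s t : left_curve s = left_curve t -> D1 (s + r1) = D1 (t + r1).
Proof. exact: addIr. Qed.

Let right_inj s t : right_curve s = right_curve t -> D2 (s - r2) = D2 (t - r2).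
Proof. exact: addIr. Qed.

Lemma product_immersion t : 'D_1 product_curve t != 0.
Proof.
have [t0|t0] := ltP t 0; first by rewrite product_left_derive//; exact: curve_immersion.
by rewrite product_right_derive//; exact: curve_immersion.
Qed.

Lemma product_long :
  exists M : R, forall t : R, M <= `|t| -> product_curve t = (t, 0).
Proof.
case: (radiusP D1); rewrite -/r1 => r1_ge1 std1 _.
case: (radiusP D2); rewrite -/r2 => r2_ge1 std2 _.
exists (2 * r1 + 2 * r2) => t; have [t0|t0] := ltP t 0.
  rewrite product_left_val// ltr0_norm// => Mt; rewrite /left_curve std1.
    by congr pair; rewrite /= ?addr0// addrK.
  by rewrite ltr0_norm; lra.
rewrite product_right_val// ger0_norm// => Mt; rewrite /right_curve std2.
  by congr pair; rewrite /= ?addr0// subrK.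
by rewrite gtr0_norm; lra.
Qed.

Lemma product_transverse s t : s != t -> product_curve s = product_curve t ->
  det2 ('D_1 product_curve s) ('D_1 product_curve t) != 0.
Proof.
move=> st e; have := product_same_side e; have [s0|s0] := ltP s 0 => /esym.
  move=> t0; move: e; rewrite !product_left_val// !product_left_derive// => /left_inj.
  by apply: curve_transverse; rewrite (inj_eq (addIr _)).
move=> /negbT; rewrite -leNgt => t0.
move: e; rewrite !product_right_val// !product_right_derive// => /right_inj.
by apply: curve_transverse; rewrite (inj_eq (addIr _)).
Qed.

Lemma product_double r s t :
  product_curve r = product_curve s -> product_curve s = product_curve t ->
  r = s \/ s = t \/ r = t.
Proof.
move=> e e'; have := product_same_side e; have := product_same_side e'.
have [s0|s0] := ltP s 0 => /esym.
  move=> t0 r0; move: e e'; rewrite !product_left_val// => /left_inj e /left_inj e'.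
  by case: (curve_double e e') => [|[]] /addIr; tauto.
move=> /negbT; rewrite -leNgt => t0 /negbT; rewrite -leNgt => r0.
move: e e'; rewrite !product_right_val// => /right_inj e /right_inj e'.
by case: (curve_double e e') => [|[]] /addIr; tauto.
Qed.

Lemma product_over_double o u :
  product_over (o, u) -> o != u /\ product_curve o = product_curve u.
Proof.
case=> -[/= o0 u0 /over_double[]]; rewrite (inj_eq (addIr _)) => ne e; split=> //.
  by rewrite !product_left_val// /left_curve e.
by rewrite !product_right_val// /right_curve e.
Qed.

Lemma product_over_asym o u : product_over (o, u) -> ~ product_over (u, o).
Proof.
case=> -[/= o0 u0 ov] [[/= u0' o0' ov']|[/= u0' o0' ov']]; try lra.
  exact: over_asym ov ov'.
exact: over_asym ov ov'.
Qed.

Definition diagram_product : diagram R :=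
  Diagram product_smooth product_immersion product_long product_transverse
    product_double product_over_double product_over_asym.

End Product.

(* Diagrams are considered up to an ambient isotopy [H] of the plane with
   compact support, and up to an increasing reparametrization [sigma]
   (necessarily bijective, and the identity near infinity, since both curves
   are standard there). *)
Definition ambient_isotopy (R : realType) (H : R * (R * R) -> R * R) : Prop :=
  [/\ smooth H,
      forall p, H (0, p) = p,
      exists r : R, forall u p, r <= `|p| -> H (u, p) = p
    & exists G : R * (R * R) -> R * R,
        smooth G /\ forall u p, G (u, H (u, p)) = p /\ H (u, G (u, p)) = p].

Definition planar_isotopic (R : realType) (D D' : diagram R) : Prop :=
  exists (H : R * (R * R) -> R * R) (sigma : R -> R),
    [/\ ambient_isotopy H,
        smooth sigma /\ (forall t, 0 < 'D_1 sigma t),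
        forall t, D' t = H (1, D (sigma t))
      & forall o u, over D' (o, u) <-> over D (sigma o, sigma u)].

(* The Reidemeister moves are performed in the square [box]; together with
   planar isotopy this covers every disc of the plane.  In each move a single
   arc of the diagram, parametrized by an interval [a, b], is replaced by
   another one. *)
Section Moves.
Variables (R : realType).
Implicit Types (D : diagram R) (a b c d e g : R) (f h : R -> R).

Definition box : set (R * R) := [set p | `|p.1| <= 1 /\ `|p.2| <= 1].

Definition agree_off D D' a b : Prop :=
  [/\ a < b,
      forall t, t \notin `[a, b] -> D t = D' t
    & forall o u, o \notin `[a, b] -> u \notin `[a, b] ->
        (over D (o, u) <-> over D' (o, u))].

(* The part of [D] parametrized by [a, b] runs along the graph of [f], from
   one vertical side of [box] to the other, in either direction. *)
Definition graph_strand D a b f : Prop :=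
  [/\ a < b, smooth f, forall t, t \in `[a, b] -> (D t).2 = f (D t).1
    & ((D a).1 = -1 /\ (D b).1 = 1) \/ ((D a).1 = 1 /\ (D b).1 = -1)].

Inductive passage := Above | Below | Virtually.

Definition passes D (p : passage) (A B : set R) : Prop :=
  forall s t, A s -> B t -> D s = D t ->
    match p with
    | Above => over D (s, t)
    | Below => over D (t, s)
    | Virtually => ~ over D (s, t) /\ ~ over D (t, s)
    end.

(* An arc without self-intersection, alone in the box, is replaced by an arc
   with exactly one self-intersection, classical or virtual: such an arc of a
   disc is a curl. *)
Definition move1 D D' : Prop :=
  exists a b, [/\ agree_off D D' a b,
    D @^-1` box = `[a, b]%classic,
    D' @^-1` box = `[a, b]%classic,
    forall s t, s \in `[a, b] -> t \in `[a, b] -> D s = D t -> s = t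
  & exists s0 t0, [/\ a <= s0 < t0, t0 <= b, D' s0 = D' t0
    & forall s t, a <= s < t -> t <= b -> D' s = D' t -> s = s0 /\ t = t0]].

(* The moving arc [a, b] runs along the graph of a function, which is pushed
   across the fixed strand [c, d], running along y = 0.  At both new crossings
   it passes over, or under, or virtually. *)
Definition move2 D D' : Prop :=
  exists a b c d f h, [/\ agree_off D D' a b,
    D @^-1` box = `[a, b]%classic `|` `[c, d]%classic,
    D' @^-1` box = `[a, b]%classic `|` `[c, d]%classic,
    [/\ graph_strand D a b f, graph_strand D' a b h,
        graph_strand D c d (fun=> 0) & graph_strand D' c d (fun=> 0)]
  & [/\ forall x, x \in `[-1, 1] -> 0 < f x < 1 /\ `|h x| < 1,
        exists x1 x2, [/\ -1 < x1 < x2, x2 < 1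
          & forall x, x \in `[-1, 1] -> (h x = 0 <-> x = x1 \/ x = x2)]
      & exists p, passes D' p `[a, b]%classic `[c, d]%classic]].

(* The moving arc [a, b], with slope in ]-1, 1[, is pushed from below to above
   the crossing at the origin of the two fixed strands [c, d] and [e, g],
   running along the diagonals y = x and y = - x.  It passes over both strands,
   or under both, in which case they must cross classically (a classical
   triple has a highest strand, which may be taken as the moving one), or
   virtually through both, in which case their crossing is arbitrary (the
   virtual and the mixed moves). *)
Definition move3 D D' : Prop :=
  exists a b c d e g f h, [/\ agree_off D D' a b,
    D @^-1` box = `[a, b]%classic `|` `[c, d]%classic `|` `[e, g]%classic,
    D' @^-1` box = `[a, b]%classic `|` `[c, d]%classic `|` `[e, g]%classic,
    [/\ graph_strand D a b f, graph_strand D' a b h,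
        graph_strand D c d id /\ graph_strand D' c d id
      & graph_strand D e g -%R /\ graph_strand D' e g -%R]
  & [/\ forall x, x \in `[-1, 1] ->
          [/\ `|f x| < 1, `|h x| < 1, `|'D_1 f x| < 1 & `|'D_1 h x| < 1],
        f 0 < 0 < h 0
      & exists p, [/\
          passes D p `[a, b]%classic (`[c, d]%classic `|` `[e, g]%classic),
          passes D' p `[a, b]%classic (`[c, d]%classic `|` `[e, g]%classic)
        & p = Virtually \/ forall s t, s \in `[c, d] -> t \in `[e, g] ->
            D s = D t -> over D (s, t) \/ over D (t, s)]]].

Definition elementary_move D D' : Prop :=
  [\/ planar_isotopic D D', move1 D D', move2 D D' | move3 D D'].

Definition equivalent : diagram R -> diagram R -> Prop :=
  clos_refl_sym_trans (diagram R) elementary_move.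

End Moves.

HB.instance Definition _ (R : realType) := gen_eqMixin (diagram R).
HB.instance Definition _ (R : realType) := gen_choiceMixin (diagram R).

Section Knots.
Local Open Scope quotient_scope.
Variable R : realType.

Definition equivalentb : rel (diagram R) := fun D D' => `[< equivalent D D' >].

Lemma equivalentb_refl : reflexive equivalentb.
Proof. by move=> D; apply/asboolP; exact: rst_refl. Qed.

Lemma equivalentb_sym : symmetric equivalentb.
Proof. by move=> D D'; apply/asboolP/asboolP; exact: rst_sym. Qed.

Lemma equivalentb_trans : transitive equivalentb.
Proof.
move=> D' D D'' /asboolP DD' /asboolP D'D''; apply/asboolP.
exact: rst_trans DD' D'D''.
Qed.

Canonical equivalent_equiv :=
  EquivRel equivalentb equivalentb_refl equivalentb_sym equivalentb_trans.

Definition long_virtual_knot : Type := {eq_quot equivalentb}.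

Definition knot_of (D : diagram R) : long_virtual_knot :=
  \pi_({eq_quot equivalentb}) D.

Definition diagram_of (K : long_virtual_knot) : diagram R := repr K.

(* The next three notions do not depend on the choice of diagrams. *)
Definition knot_product (K1 K2 : long_virtual_knot) : long_virtual_knot :=
  knot_of (diagram_product (diagram_of K1) (diagram_of K2)).

Definition EO (K : long_virtual_knot) : long_virtual_knot :=
  knot_of (diagram_EO (diagram_of K)).

Definition W (K : long_virtual_knot) (F : fieldType) (x : F) : F :=
  diagram_W (diagram_of K) x.

End Knots.

(* Z[s, s^-1] is a subring of this fraction field of Z[s], where W_K(s) and
   W_K(s^-1) are the values of [W K] at [s_var] and [s_var^-1]. *)
Definition s_var : {fraction {poly int}} := tofrac 'X.

(* Main.v *)
From HB Require Import structures.
From mathcomp Require Import all_boot all_order all_algebra.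
From mathcomp Require Import all_classical all_reals all_analysis.
From mathcomp Require Import generic_quotient fraction ring lra zify.
From Stdlib Require Import Relations.Relation_Operators.
Require Import Defs.

(* Let h(t) be the sum of the signs of the over- and underpass points before t, a
   point t of a crossing counting for one half.  The exponent of s contributed to
   W_K by a crossing c = (o, u) is then h(u) - h(o), whether c is EO or EU; let
   w_c(s) be its contribution.  The sum over all pairs of crossings
     A(s) = sum_(c, d) w_c(s) w_d(s^-1) (sgn (o_d - o_c) + sgn (u_d - u_c))
   is invariant under the Reidemeister moves.  In move I the new crossing has
   weight 0, in move II the two new crossings have opposite weights, and in move
   III the only terms that change are those of the pairs of crossings which share
   the top strand (through o) or the bottom strand (through u).  The three
   exponents satisfy e_TB = e_TM + e_MB, and these two variations cancel because
   the two weights are taken at inverse values of s.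
   In a product K1 K2 a pair of crossings in different factors contributes
   +2 or -2, so that
     A_(K1 K2)(s) = A_K1(s) + A_K2(s) + 2 (W_K1(s) W_K2(s^-1) - W_K1(s^-1) W_K2(s)).
   Hence W_K1(s) W_K2(s^-1) is symmetric under s <-> s^-1 when K1 and K2 commute.
   The second equality comes from the same computation with A_EO(K), which is an
   invariant of K since crossing changes towards EO transform move III into
   move III: the strands remain stacked in layers, ordered by time. *)

Set Implicit Arguments.
Unset Strict Implicit.
Unset Printing Implicit Defensive.

Import Order.TTheory GRing.Theory Num.Theory.
Import numFieldNormedType.Exports.

Local Open Scope classical_set_scope.
Local Open Scope ring_scope.

(** * Gauss diagrams *)

Section Gauss.
Variable R : realDomainType.
Implicit Types (T M B : interval R) (c d : R * R) (s C L : seq (R * R)) (w e : R * R -> int).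

(** W is additive under products, hence blind to the order of the factors; a finer quantity is
    needed, quadratic in the weights and antisymmetric in the order of the crossings. [lag] compares
    over points with over points and under points with under points only. On the middle strand of a
    move III lie the under point of TM and the over point of MB, which [lag] never compares: this is
    why only the reversals on T and B show up. If P and Q are the monomials of TM and MB, that of TB
    is PQ, and the two variations are, up to a common factor, (P - 1)(1/(PQ) - 1) - (PQ - 1)(1/P -
    1) and (PQ - 1)(1/Q - 1) - (Q - 1)(1/(PQ) - 1), whose sum is 0. Comparing K1 K2 with K2 K1
    yields 4 times the desired difference, so the conclusion is drawn in a field where 4 is not 0,
    such as the fractions of Z[s]. *)

Definition lag c d : int := sgz (d.1 - c.1) + sgz (d.2 - c.2).

Lemma sgzBC (x y : R) : sgz (y - x) = - sgz (x - y).
Proof. by rewrite -sgzN opprB. Qed.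

Lemma lagC c d : lag d c = - lag c d.
Proof. by rewrite /lag (sgzBC d.1) (sgzBC d.2) opprD. Qed.

Lemma lag_self c : lag c c = 0.
Proof. by rewrite /lag !subrr sgz0 addr0. Qed.

Definition height w s (t : R) : int :=
  \sum_(d <- s) w d * (sgz (t - d.1) - sgz (t - d.2)).

(* For the chord c = (o, u) of a crossing, [grade c] is the exponent of s in
   W_K(s): alpha(c) if c is EO, - alpha(c) if it is EU.  Since sgz 0 = 0, it is
   exactly half of a difference of heights, which treats EO and EU chords
   uniformly. *)
Record gauss := Gauss {
  chord : seq (R * R);
  sign : R * R -> int;
  grade : R * R -> int;
  gradeP : {in chord, forall c,
    2 * grade c = height sign chord c.2 - height sign chord c.1} }.

Section Invariants.
Variables (F : fieldType) (x : F).

Definition weight w e (y : F) c : F := (w c)%:~R * (y ^ e c - 1).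

Definition form (f g : R * R -> F) s : F :=
  \sum_(c <- s) \sum_(d <- s) f c * g d * (lag c d)%:~R.

Definition gauss_W (G : gauss) : F :=
  \sum_(c <- chord G) weight (sign G) (grade G) x c.

Definition gauss_form (G : gauss) : F :=
  form (weight (sign G) (grade G) x) (weight (sign G) (grade G) x^-1) (chord G).

End Invariants.

Definition same_invariants (G G' : gauss) : Prop :=
  forall (F : fieldType) (x : F), x != 0 ->
    gauss_W x G = gauss_W x G' /\ gauss_form x G = gauss_form x G'.

(** * The quadratic form of a list of chords *)

Section FormLemmas.
Variables (F : fieldType).
Implicit Types f g : R * R -> F.

Lemma form_perm f g s s' : perm_eq s s' -> form f g s = form f g s'.
Proof.
move=> ss'; rewrite /form (perm_big _ ss'); apply: eq_bigr => c _.
exact: perm_big.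
Qed.

Lemma eq_form f g f' g' s : {in s, f =1 f'} -> {in s, g =1 g'} ->
  form f g s = form f' g' s.
Proof.
move=> ff gg; rewrite /form; apply: eq_big_seq => c cs; apply: eq_big_seq => d ds.
by rewrite ff// gg.
Qed.

(** As [lag] is antisymmetric, the two families of mixed terms merge into a combination
    antisymmetric in f and g. This is the source of the difference of products of W in
    [gauss_product]. *)
Lemma form_cat f g s s' : form f g (s ++ s') =
  form f g s + form f g s' +
  \sum_(c <- s) (f c * \sum_(d <- s') g d * (lag c d)%:~R
               - g c * \sum_(d <- s') f d * (lag c d)%:~R).
Proof.
rewrite /form big_cat /=.
under eq_bigr do rewrite big_cat /=.
under [X in _ + X = _]eq_bigr do rewrite big_cat /=.
rewrite !big_split /=.
set A := \sum_(c <- s) \sum_(d <- s) _; set B := \sum_(c <- s') \sum_(d <- s') _.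
set X := \sum_(c <- s) \sum_(d <- s') _; set Y := \sum_(c <- s') \sum_(d <- s) _.
set X' := \sum_(c <- s) _; set Y' := \sum_(c <- s) _.
have -> : X = X'.
  by apply: eq_bigr => c _; rewrite mulr_sumr; apply: eq_bigr => d _; rewrite mulrA.
have -> : Y = Y'; last by ring.
rewrite /Y exchange_big /=; apply: eq_bigr => c _.
rewrite mulr_sumr -sumrN; apply: eq_bigr => d _.
by rewrite (lagC c d) rmorphN /=; ring.
Qed.

Lemma form_local f g f' g' C L L' :
  {in C, f =1 f'} -> {in C, g =1 g'} ->
  {in C, forall c, \sum_(d <- L) f d * (lag c d)%:~R =
                   \sum_(d <- L') f' d * (lag c d)%:~R} ->
  {in C, forall c, \sum_(d <- L) g d * (lag c d)%:~R =
                   \sum_(d <- L') g' d * (lag c d)%:~R} ->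
  form f g L = form f' g' L' ->
  form f g (C ++ L) = form f' g' (C ++ L').
Proof.
move=> ff gg sf sg eL; rewrite !form_cat eL (eq_form ff gg); congr (_ + _).
by apply: eq_big_seq => c cC; rewrite ff// gg// sf// sg.
Qed.

End FormLemmas.

(** * Gauss diagrams that differ by a local change *)

Definition off T C : Prop :=
  {in C, forall c, c.1 \notin T /\ c.2 \notin T}.

Definition apart T M : Prop := {in T, forall x, x \notin M}.

(** Intervals are convex, so a point outside T is on the same side of all points of T. Seen from
    elsewhere, a strand behaves like a single parameter. *)
Lemma sgz_off T x y p : x \in T -> y \in T -> p \notin T ->
  sgz (p - x) = sgz (p - y).
Proof.
case: T => l r; rewrite !itv_boundlr => /andP[lx xr] /andP[ly yr].
rewrite negb_and -!ltNge => /orP[pl|rp].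
  have px := lt_le_trans pl lx; have py := lt_le_trans pl ly.
  by rewrite !ltr0_sgz// subr_lt0; move: px py; rewrite !bnd_simp.
have px := le_lt_trans xr rp; have py := le_lt_trans yr rp.
by rewrite !gtr0_sgz// subr_gt0; move: px py; rewrite !bnd_simp.
Qed.

Lemma sgz_apart T M x x' y y' : apart T M ->
  x \in T -> x' \in T -> y \in M -> y' \in M -> sgz (x - y) = sgz (x' - y').
Proof.
move=> TM xT x'T yM y'M.
rewrite (sgz_off yM y'M (TM _ xT)) [LHS]sgzBC [RHS]sgzBC; congr (- _).
by apply: sgz_off x'T _ => //; apply/negP => /TM; rewrite y'M.
Qed.

Lemma height_cat w s s' t : height w (s ++ s') t = height w s t + height w s' t.
Proof. exact: big_cat. Qed.

Lemma height_perm w s s' t : perm_eq s s' -> height w s t = height w s' t.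
Proof. exact: perm_big. Qed.

Lemma height_strand T w w' C x y : off T C ->
  {in C, w =1 w'} -> x \in T -> y \in T -> height w C x = height w' C y.
Proof.
move=> oT ww xT yT; apply: eq_big_seq => d dC; rewrite ww//.
have [d1 d2] := oT d dC.
by rewrite [sgz (x - d.1)]sgzBC [sgz (x - d.2)]sgzBC (sgz_off xT yT d1) (sgz_off xT yT d2)
  -!sgzBC.
Qed.

Lemma mulz2I (m n : int) : 2 * m = 2 * n -> m = n.
Proof. lia. Qed.

(** The common frame of the moves: L is replaced by L' while the chords of C stay. Equal heights of
    L and L' at the ends of C keep the grades on C, and equal [lag]-weighted sums keep the mixed
    terms of the form; there remain the terms internal to L and L'. *)
Lemma gauss_local (G G' : gauss) C L L' :
  perm_eq (chord G) (C ++ L) -> perm_eq (chord G') (C ++ L') ->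
  {in C, sign G =1 sign G'} ->
  {in C, forall c, height (sign G) L c.1 = height (sign G') L' c.1 /\
                   height (sign G) L c.2 = height (sign G') L' c.2} ->
  (forall (F : fieldType) (x : F), x != 0 ->
    let f (y : F) := weight (sign G) (grade G) y in
    let f' (y : F) := weight (sign G') (grade G') y in
    [/\ {in C, forall c, \sum_(d <- L) f x d * (lag c d)%:~R =
                         \sum_(d <- L') f' x d * (lag c d)%:~R},
        \sum_(d <- L) f x d = \sum_(d <- L') f' x d
      & form (f x) (f x^-1) L = form (f' x) (f' x^-1) L']) ->
  same_invariants G G'.
Proof.
move=> pG pG' ww hh loc F x x0.
have gg : {in C, grade G =1 grade G'}.
  move=> c cC; apply: mulz2I.
  have cG : c \in chord G by rewrite (perm_mem pG) mem_cat cC.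
  have cG' : c \in chord G' by rewrite (perm_mem pG') mem_cat cC.
  rewrite gradeP// gradeP// !(height_perm _ _ pG) !(height_perm _ _ pG') !height_cat.
  have [-> ->] := hh c cC.
  have hC t : height (sign G) C t = height (sign G') C t.
    by apply: eq_big_seq => d dC; rewrite ww.
  by rewrite !hC.
have ff (y : F) : {in C, weight (sign G) (grade G) y =1 weight (sign G') (grade G') y}.
  by move=> c cC; rewrite /weight ww// gg.
have [l1 l2 l3] := loc F x x0.
(* The mixed terms also involve the weights at x^-1, so the local hypothesis is used there too. *)
have [|l4 _ _] := loc F x^-1; first by rewrite invr_eq0.
split.
  rewrite /gauss_W (perm_big _ pG) (perm_big _ pG') !big_cat /= l2; congr (_ + _).
  exact: eq_big_seq.
rewrite /gauss_form (form_perm _ _ pG) (form_perm _ _ pG').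
exact: form_local.
Qed.

Lemma same_invariants_eq (G G' : gauss) C :
  perm_eq (chord G) C -> perm_eq (chord G') C -> {in C, sign G =1 sign G'} ->
  same_invariants G G'.
Proof.
move=> pG pG' ww; apply: (@gauss_local G G' C [::] [::]); rewrite ?cats0//.
  by move=> c _; rewrite /height !big_nil.
by move=> F x x0 f f'; split=> [c _||]; rewrite /form !big_nil.
Qed.

(** No chord of C ends in T, so C has the same height at both ends of k, and k itself contributes
    equally at both: its grade is 0, hence also its weight. *)
Lemma isolated_chord T (G G' : gauss) C k :
  off T C -> k.1 \in T -> k.2 \in T ->
  perm_eq (chord G) C -> perm_eq (chord G') (C ++ [:: k]) ->
  {in C, sign G =1 sign G'} -> same_invariants G G'.
Proof.
move=> oT k1 k2 pG pG' ww.
have gk : grade G' k = 0.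
  apply: mulz2I; rewrite gradeP ?(perm_mem pG') ?mem_cat ?inE ?eqxx ?orbT//.
  rewrite !(height_perm _ _ pG') !height_cat.
  rewrite (@height_strand T _ (sign G') C k.2 k.1)//.
  rewrite /height !big_seq1 !subrr !sgz0 (sgzBC k.1 k.2); ring.
have fk (F : fieldType) (x : F) : weight (sign G') (grade G') x k = 0.
  by rewrite /weight gk expr0z subrr mulr0.
apply: (@gauss_local G G' C [::] [:: k]); rewrite ?cats0//.
  move=> c cC; have [c1 c2] := oT c cC; rewrite /height !big_nil !big_seq1.
  by rewrite (sgz_off k1 k2 c1) (sgz_off k1 k2 c2) !subrr mulr0.
move=> F x x0 f f'; split=> [c _||]; rewrite /form ?big_nil ?big_seq1 /f' ?fk ?mul0r//.
Qed.

(** C has equal heights at k and l, whose ends share the strands T and M, and the mutual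
    contributions of k and l balance. The grades therefore agree, and opposite signs give opposite
    weights. In the form, the terms (k, l) and (l, k) cancel by antisymmetry of [lag], whatever the
    directions of the two strands. *)
Lemma bigon_chords T M (G G' : gauss) C k l :
  apart T M -> off T C -> off M C ->
  k.1 \in T -> l.1 \in T -> k.2 \in M -> l.2 \in M ->
  sign G' l = - sign G' k ->
  perm_eq (chord G) C -> perm_eq (chord G') (C ++ [:: k; l]) ->
  {in C, sign G =1 sign G'} -> same_invariants G G'.
Proof.
move=> TM oT oM k1 l1 k2 l2 wl pG pG' ww.
have gkl : grade G' k = grade G' l.
  apply: mulz2I; rewrite !gradeP ?(perm_mem pG') ?mem_cat ?inE ?eqxx ?orbT//.
  rewrite !(height_perm _ _ pG') !height_cat.
  rewrite (@height_strand T _ (sign G') C k.1 l.1)//.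
  rewrite (@height_strand M _ (sign G') C k.2 l.2)//.
  rewrite /height !big_cons !big_nil wl !subrr !sgz0.
  rewrite (sgzBC l.1 k.1) (sgzBC l.2 k.2).
  rewrite (sgzBC l.1 k.2) (sgzBC k.1 k.2) (sgzBC k.1 l.2) (sgzBC l.1 l.2).
  rewrite (sgz_apart TM l1 k1 l2 k2) (sgz_apart TM l1 k1 k2 k2) (sgz_apart TM k1 k1 l2 k2).
  ring.
have fl (F : fieldType) (x : F) : weight (sign G') (grade G') x l =
    - weight (sign G') (grade G') x k.
  by rewrite /weight wl gkl rmorphN mulNr.
apply: (@gauss_local G G' C [::] [:: k; l]); rewrite ?cats0//.
  move=> c cC; have [c1 c2] := oT c cC; have [c1' c2'] := oM c cC.
  rewrite /height !big_nil !big_cons !big_nil wl.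
  rewrite (sgz_off k1 l1 c1) (sgz_off k1 l1 c2) (sgz_off k2 l2 c1') (sgz_off k2 l2 c2').
  by split; ring.
move=> F x x0 f f'; rewrite /form !big_nil; split.
- move=> c cC; rewrite !big_cons !big_nil /f' fl.
  have [c1 _] := oT c cC; have [_ c2] := oM c cC.
  rewrite /lag ![sgz (_ - c.1)]sgzBC ![sgz (_ - c.2)]sgzBC.
  by rewrite (sgz_off k1 l1 c1) (sgz_off k2 l2 c2); ring.
- by rewrite !big_cons !big_nil /f' fl; ring.
- rewrite !big_cons !big_nil /f' !fl !lag_self (lagC k l) rmorphN /=; ring.
Qed.

Lemma unit_sq (a : int) : a ^+ 2 = 1 -> a = 1 \/ a = -1.
Proof. by move/eqP; rewrite sqrf_eq1 => /orP[] /eqP; [left|right]. Qed.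

(* The three strands of a Reidemeister move III are the top one T, the middle one
   M and the bottom one B.  On T, the points t1 and t2 are the crossings with M
   and B; on M, m1 and m2 are the crossings with T and B; on B, b1 and b2 are the
   crossings with T and M.  The move reverses the order on each strand.  The
   directions of the strands are encoded by a, b, c, and d distinguishes a
   configuration from its mirror image. *)
Section Triangle.
Variables (T M B : interval R).
Hypotheses (TM : apart T M) (TB : apart T B) (MB : apart M B).
Variables (t0 m0 b0 : R).
Hypotheses (t0T : t0 \in T) (m0M : m0 \in M) (b0B : b0 \in B).

Definition triangle (t1 t2 m1 m2 b1 b2 : R) := [:: (t1, m1); (t2, b1); (m2, b2)].

Let p := sgz (t0 - m0).
Let q := sgz (t0 - b0).
Let r := sgz (m0 - b0).

(** The corrections are even in (a, b, c), so reversing the order on all three strands keeps the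
    grades. The factor p + r - q = sgn (t0 - m0) + sgn (m0 - b0) + sgn (b0 - t0) records the cyclic
    order of T, M, B along the line. *)
Lemma triangle_grades (G : gauss) C w (t1 t2 m1 m2 b1 b2 : R) (d a b c : int) :
  off T C -> off M C -> off B C -> {in C, sign G =1 w} ->
  perm_eq (chord G) (C ++ triangle t1 t2 m1 m2 b1 b2) ->
  t1 \in T -> t2 \in T -> m1 \in M -> m2 \in M -> b1 \in B -> b2 \in B ->
  d ^+ 2 = 1 -> a ^+ 2 = 1 -> b ^+ 2 = 1 -> c ^+ 2 = 1 ->
  sgz (t1 - t2) = - a -> sgz (m1 - m2) = - b -> sgz (b1 - b2) = - c ->
  sign G (t1, m1) = d * a * b -> sign G (t2, b1) = d * a * c ->
  sign G (m2, b2) = d * b * c ->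
  [/\ 2 * grade G (t1, m1) = height w C m0 - height w C t0 - d * (a + b) * c * (p + r - q),
      2 * grade G (m2, b2) = height w C b0 - height w C m0 + d * a * (b + c) * (p + r - q),
      2 * grade G (t2, b1) = height w C b0 - height w C t0 + d * b * (a - c) * (p + r - q)
    & grade G (t2, b1) = grade G (t1, m1) + grade G (m2, b2)].
Proof.
move=> oT oM oB ww pG t1T t2T m1M m2M b1B b2B d2 a2 b2' c2 tt mm bb w1 w2 w3.
have gr k : k \in triangle t1 t2 m1 m2 b1 b2 -> 2 * grade G k =
    height w C k.2 - height w C k.1 +
    (height (sign G) (triangle t1 t2 m1 m2 b1 b2) k.2
     - height (sign G) (triangle t1 t2 m1 m2 b1 b2) k.1).
  move=> kL; rewrite gradeP ?(perm_mem pG) ?mem_cat ?kL ?orbT//.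
  rewrite !(height_perm _ _ pG) !height_cat.
  have hC t : height (sign G) C t = height w C t by apply: eq_big_seq => k' /ww->.
  by rewrite !hC; ring.
have tm x y : x \in T -> y \in M -> sgz (x - y) = p /\ sgz (y - x) = - p.
  by move=> xT yM; rewrite (sgzBC x) (sgz_apart TM xT t0T yM m0M).
have tb x y : x \in T -> y \in B -> sgz (x - y) = q /\ sgz (y - x) = - q.
  by move=> xT yM; rewrite (sgzBC x) (sgz_apart TB xT t0T yM b0B).
have mb x y : x \in M -> y \in B -> sgz (x - y) = r /\ sgz (y - x) = - r.
  by move=> xT yM; rewrite (sgzBC x) (sgz_apart MB xT m0M yM b0B).
have hT x y : x \in T -> y \in T -> height w C x = height w C y by exact: height_strand.
have hM x y : x \in M -> y \in M -> height w C x = height w C y by exact: height_strand.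
have hB x y : x \in B -> y \in B -> height w C x = height w C y by exact: height_strand.
have [tm1 tm1'] := tm _ _ t1T m1M; have [tm2 tm2'] := tm _ _ t1T m2M.
have [tm3 tm3'] := tm _ _ t2T m1M; have [tm4 tm4'] := tm _ _ t2T m2M.
have [tb1 tb1'] := tb _ _ t1T b1B; have [tb2 tb2'] := tb _ _ t1T b2B.
have [tb3 tb3'] := tb _ _ t2T b1B; have [tb4 tb4'] := tb _ _ t2T b2B.
have [mb1 mb1'] := mb _ _ m1M b1B; have [mb2 mb2'] := mb _ _ m1M b2B.
have [mb3 mb3'] := mb _ _ m2M b1B; have [mb4 mb4'] := mb _ _ m2M b2B.
have := gr (t1, m1); have := gr (m2, b2); have := gr (t2, b1).
rewrite /triangle !inE !eqxx !orbT /= /height !big_cons !big_nil /= !subrr !sgz0.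
rewrite w1 w2 w3 -!/(height w C _).
rewrite (sgzBC t1 t2) (sgzBC m1 m2) (sgzBC b1 b2) tt mm bb.
rewrite tm1 tm1' tm2 tm2' tm3 tm3' tm4 tm4'.
rewrite tb1 tb1' tb2 tb2' tb3 tb3' tb4 tb4'.
rewrite mb1 mb1' mb2 mb2' mb3 mb3' mb4 mb4'.
rewrite (hT t1 t0)// (hT t2 t0)// (hM m1 m0)// (hM m2 m0)// (hB b1 b0)// (hB b2 b0)//.
move=> /(_ isT) e2 /(_ isT) e3 /(_ isT) e1.
have {}d2 := unit_sq d2; have {}a2 := unit_sq a2.
have {}b2' := unit_sq b2'; have {}c2 := unit_sq c2.
split; last (apply: mulz2I; rewrite mulrDr); rewrite ?e1 ?e2 ?e3;
  by case: d2 => ->; case: a2 => ->; case: b2' => ->; case: c2 => ->; ring.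
Qed.

(** Besides the weights, the right-hand side contains only the relative positions p and r of the
    strands, and no longer the orders on T and B. It therefore takes the same value before and after
    the move. *)
Lemma triangle_local (G : gauss) C w (t1 t2 m1 m2 b1 b2 : R) (d a b c : int)
    (F : fieldType) (x : F) :
  off T C -> off M C -> off B C -> {in C, sign G =1 w} ->
  perm_eq (chord G) (C ++ triangle t1 t2 m1 m2 b1 b2) ->
  t1 \in T -> t2 \in T -> m1 \in M -> m2 \in M -> b1 \in B -> b2 \in B ->
  d ^+ 2 = 1 -> a ^+ 2 = 1 -> b ^+ 2 = 1 -> c ^+ 2 = 1 ->
  sgz (t1 - t2) = - a -> sgz (m1 - m2) = - b -> sgz (b1 - b2) = - c ->
  sign G (t1, m1) = d * a * b -> sign G (t2, b1) = d * a * c ->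
  sign G (m2, b2) = d * b * c -> x != 0 ->
  let f (y : F) := weight (sign G) (grade G) y in
  let k1 := (t1, m1) in let k2 := (t2, b1) in let k3 := (m2, b2) in
  form (f x) (f x^-1) (triangle t1 t2 m1 m2 b1 b2) =
  - (f x k1 * f x^-1 k2 - f x k2 * f x^-1 k1) * r%:~R
  - (f x k1 * f x^-1 k3 - f x k3 * f x^-1 k1) * (p + r)%:~R
  - (f x k2 * f x^-1 k3 - f x k3 * f x^-1 k2) * p%:~R.
Proof.
move=> oT oM oB ww pG t1T t2T m1M m2M b1B b2B d2 a2 b2' c2 tt mm bb w1 w2 w3 x0 f.
(* The grade of the chord TB is the sum of those of TM and MB; as the second weight
   is taken at x^-1, this makes the variations on T and on B cancel. *)
have [_ _ _ gg] := triangle_grades oT oM oB ww pG t1T t2T m1M m2M b1B b2B d2 a2 b2' c2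
  tt mm bb w1 w2 w3.
rewrite /= /form !big_cons !big_nil !lag_self /=.
rewrite (lagC (t1, m1) (t2, b1)) (lagC (t1, m1) (m2, b2)) (lagC (t2, b1) (m2, b2)).
have -> : lag (t1, m1) (t2, b1) = a - r.
  by rewrite /lag /= (sgzBC t1) tt (sgzBC m1) (sgz_apart MB m1M m0M b1B b0B) opprK.
have -> : lag (t1, m1) (m2, b2) = - p - r.
  rewrite /lag /= (sgzBC t1) (sgzBC m1) (sgz_apart TM t1T t0T m2M m0M).
  by rewrite (sgz_apart MB m1M m0M b2B b0B).
have -> : lag (t2, b1) (m2, b2) = - p + c.
  by rewrite /lag /= (sgzBC t2) (sgz_apart TM t2T t0T m2M m0M) (sgzBC b1) bb opprK.
rewrite /f /weight gg w1 w2 w3 !expfzDr ?invr_eq0// !exprz_inv -!invr_expz.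
have P0 := expfz_neq0 (grade G (t1, m1)) x0; have Q0 := expfz_neq0 (grade G (m2, b2)) x0.
move: (x ^ _) (x ^ _) P0 Q0 => P Q P0 Q0.
have {}d2 := unit_sq d2; have {}a2 := unit_sq a2.
have {}b2' := unit_sq b2'; have {}c2 := unit_sq c2.
rewrite !(rmorphN, rmorphD, rmorphM, rmorphB) /=.
case: d2 => ->; case: a2 => ->; case: b2' => ->; case: c2 => ->;
  rewrite ?rmorphN ?rmorph1; field; by rewrite P0 Q0.
Qed.

Lemma triangle_chords (G G' : gauss) C (t1 t2 m1 m2 b1 b2 t1' t2' m1' m2' b1' b2' : R)
    (d a b c : int) :
  off T C -> off M C -> off B C -> {in C, sign G =1 sign G'} ->
  perm_eq (chord G) (C ++ triangle t1 t2 m1 m2 b1 b2) ->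
  perm_eq (chord G') (C ++ triangle t1' t2' m1' m2' b1' b2') ->
  t1 \in T -> t2 \in T -> m1 \in M -> m2 \in M -> b1 \in B -> b2 \in B ->
  t1' \in T -> t2' \in T -> m1' \in M -> m2' \in M -> b1' \in B -> b2' \in B ->
  d ^+ 2 = 1 -> a ^+ 2 = 1 -> b ^+ 2 = 1 -> c ^+ 2 = 1 ->
  sgz (t1 - t2) = - a -> sgz (m1 - m2) = - b -> sgz (b1 - b2) = - c ->
  sgz (t1' - t2') = a -> sgz (m1' - m2') = b -> sgz (b1' - b2') = c ->
  sign G (t1, m1) = d * a * b -> sign G (t2, b1) = d * a * c ->
  sign G (m2, b2) = d * b * c ->
  sign G' (t1', m1') = d * a * b -> sign G' (t2', b1') = d * a * c ->
  sign G' (m2', b2') = d * b * c -> same_invariants G G'.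
Proof.
move=> oT oM oB ww pG pG' t1T t2T m1M m2M b1B b2B t1T' t2T' m1M' m2M' b1B' b2B'.
move=> d2 a2 b2_ c2 tt mm bb tt' mm' bb' w1 w2 w3 w1' w2' w3'.
have ww' : {in C, sign G' =1 sign G'} by [].
have neg1 (u : int) : u ^+ 2 = 1 -> (- u) ^+ 2 = 1 by rewrite sqrrN.
(* The configuration after the move is treated as the one before it with a, b, c negated and d kept;
   the crossing signs, quadratic in a, b, c, do not change. *)
have nn (u v : int) : d * u * v = d * - u * - v by ring.
move: (w1') (w2') (w3'); rewrite nn (nn a c) (nn b c) => w1n w2n w3n.
have ntt : sgz (t1' - t2') = - - a by rewrite opprK.
have nmm : sgz (m1' - m2') = - - b by rewrite opprK.
have nbb : sgz (b1' - b2') = - - c by rewrite opprK.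
have [g1 g3 g2 _] := triangle_grades oT oM oB ww pG t1T t2T m1M m2M b1B b2B d2 a2 b2_ c2
  tt mm bb w1 w2 w3.
have [g1' g3' g2' _] := triangle_grades oT oM oB ww' pG' t1T' t2T' m1M' m2M' b1B' b2B'
  d2 (neg1 _ a2) (neg1 _ b2_) (neg1 _ c2) ntt nmm nbb w1n w2n w3n.
have e1 : grade G (t1, m1) = grade G' (t1', m1').
  by apply: mulz2I; rewrite g1 g1'; ring.
have e2 : grade G (t2, b1) = grade G' (t2', b1').
  by apply: mulz2I; rewrite g2 g2'; ring.
have e3 : grade G (m2, b2) = grade G' (m2', b2').
  by apply: mulz2I; rewrite g3 g3'; ring.
apply: (gauss_local pG pG') => // [k kC|F x x0 f f'].
  have [k1T k2T] := oT k kC; have [k1M k2M] := oM k kC; have [k1B k2B] := oB k kC.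
  rewrite /height /triangle !big_cons !big_nil /= w1 w2 w3 w1' w2' w3'.
  rewrite (sgz_off t1T t1T' k1T) (sgz_off t2T t2T' k1T) (sgz_off m1M m1M' k1M).
  rewrite (sgz_off m2M m2M' k1M) (sgz_off b1B b1B' k1B) (sgz_off b2B b2B' k1B).
  rewrite (sgz_off t1T t1T' k2T) (sgz_off t2T t2T' k2T) (sgz_off m1M m1M' k2M).
  by rewrite (sgz_off m2M m2M' k2M) (sgz_off b1B b1B' k2B) (sgz_off b2B b2B' k2B).
have f1 y : f y (t1, m1) = f' y (t1', m1') by rewrite /f /f' /weight w1 w1' e1.
have f2 y : f y (t2, b1) = f' y (t2', b1') by rewrite /f /f' /weight w2 w2' e2.
have f3 y : f y (m2, b2) = f' y (m2', b2') by rewrite /f /f' /weight w3 w3' e3.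
split.
- move=> k kC; rewrite /triangle !big_cons !big_nil !f1 !f2 !f3 /lag /=.
  have [k1T k2T] := oT k kC; have [k1M k2M] := oM k kC; have [k1B k2B] := oB k kC.
  rewrite ![sgz (_ - k.1)]sgzBC ![sgz (_ - k.2)]sgzBC.
  rewrite (sgz_off t1T t1T' k1T) (sgz_off t2T t2T' k1T) (sgz_off m2M m2M' k1M).
  by rewrite (sgz_off m1M m1M' k2M) (sgz_off b1B b1B' k2B) (sgz_off b2B b2B' k2B).
- by rewrite /triangle !big_cons !big_nil !f1 !f2 !f3.
- rewrite (triangle_local oT oM oB ww pG t1T t2T m1M m2M b1B b2B d2 a2 b2_ c2
    tt mm bb w1 w2 w3 x0).
  rewrite (triangle_local oT oM oB ww' pG' t1T' t2T' m1M' m2M' b1B' b2B'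
    d2 (neg1 _ a2) (neg1 _ b2_) (neg1 _ c2) ntt nmm nbb w1n w2n w3n x0) /=.
  move: (f1 x) (f1 x^-1) (f2 x) (f2 x^-1) (f3 x) (f3 x^-1); rewrite /f /f'.
  by do 6!move=> ->.
Qed.

End Triangle.

(** * Relabelling and juxtaposition of Gauss diagrams *)

Definition order_embedding (phi : R -> R) : Prop :=
  forall x y, sgz (phi x - phi y) = sgz (x - y).

Definition relabel (phi : R -> R) c : R * R := (phi c.1, phi c.2).

Lemma lag_relabel phi c d : order_embedding phi ->
  lag (relabel phi c) (relabel phi d) = lag c d.
Proof. by move=> ophi; rewrite /lag !ophi. Qed.

Lemma form_relabel (F : fieldType) (f g f' g' : R * R -> F) phi s :
  order_embedding phi ->
  {in s, forall c, f (relabel phi c) = f' c} ->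
  {in s, forall c, g (relabel phi c) = g' c} ->
  form f g (map (relabel phi) s) = form f' g' s.
Proof.
move=> ophi ff gg; rewrite /form big_map; apply: eq_big_seq => c cs.
by rewrite big_map; apply: eq_big_seq => d ds; rewrite ff// gg// lag_relabel.
Qed.

Lemma height_relabel phi w w' s t : order_embedding phi ->
  {in s, forall c, w (relabel phi c) = w' c} ->
  height w (map (relabel phi) s) (phi t) = height w' s t.
Proof.
move=> ophi ww; rewrite /height big_map; apply: eq_big_seq => c cs.
by rewrite ww// !ophi.
Qed.

Lemma gauss_relabel (G G' : gauss) phi : order_embedding phi ->
  perm_eq (chord G) (map (relabel phi) (chord G')) ->
  {in chord G', forall c, sign G (relabel phi c) = sign G' c} ->
  same_invariants G G'.
Proof.
move=> ophi pG ww F x x0.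
have gg : {in chord G', forall c, grade G (relabel phi c) = grade G' c}.
  move=> c cG; apply: mulz2I; rewrite !gradeP ?(perm_mem pG) ?map_f//.
  by rewrite !(height_perm _ _ pG) !(height_relabel _ ophi ww).
have ff y : {in chord G', forall c, weight (sign G) (grade G) y (relabel phi c) =
    weight (sign G') (grade G') y c :> F}.
  by move=> c cG; rewrite /weight ww// gg.
split; first by rewrite /gauss_W (perm_big _ pG) big_map; apply: eq_big_seq => c /ff.
by rewrite /gauss_form (form_perm _ _ pG); exact: form_relabel.
Qed.

(** A chord of one factor has both ends on the same side of any point of the other, so its
    contributions to the height there cancel and the grades are those of the factors. Each mixed
    pair has [lag] 2, which gives the factor 2. *)
Lemma gauss_product (G G1 G2 : gauss) phi1 phi2 (F : fieldType) (x : F) :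
  order_embedding phi1 -> order_embedding phi2 ->
  perm_eq (chord G) (map (relabel phi1) (chord G1) ++ map (relabel phi2) (chord G2)) ->
  {in chord G1, forall c, sign G (relabel phi1 c) = sign G1 c} ->
  {in chord G2, forall c, sign G (relabel phi2 c) = sign G2 c} ->
  {in chord G1, forall c, phi1 c.1 < 0 /\ phi1 c.2 < 0} ->
  {in chord G2, forall c, 0 <= phi2 c.1 /\ 0 <= phi2 c.2} ->
  gauss_form x G = gauss_form x G1 + gauss_form x G2 +
    2 * (gauss_W x G1 * gauss_W x^-1 G2 - gauss_W x^-1 G1 * gauss_W x G2).
Proof.
move=> o1 o2 pG w1 w2 neg pos.
have lt_neg (u v : R) : u < 0 -> 0 <= v -> sgz (u - v) = -1.
  by move=> u0 v0; apply: ltr0_sgz; rewrite subr_lt0; apply: lt_le_trans v0.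
have g1 : {in chord G1, forall c, grade G (relabel phi1 c) = grade G1 c}.
  move=> c cG; apply: mulz2I; rewrite !gradeP ?(perm_mem pG) ?mem_cat ?map_f//.
  rewrite !(height_perm _ _ pG) !height_cat !(height_relabel _ o1 w1) /=.
  have -> : height (sign G) (map (relabel phi2) (chord G2)) (phi1 c.2) =
      height (sign G) (map (relabel phi2) (chord G2)) (phi1 c.1); last by ring.
  have [c1 c2] := neg c cG.
  rewrite /height !big_map; apply: eq_big_seq => d dG; have [d1 d2] := pos d dG.
  by rewrite /= !lt_neg.
have g2 : {in chord G2, forall c, grade G (relabel phi2 c) = grade G2 c}.
  move=> c cG; apply: mulz2I; rewrite !gradeP ?(perm_mem pG) ?mem_cat ?map_f ?orbT//.
  rewrite !(height_perm _ _ pG) !height_cat !(height_relabel _ o2 w2) /=.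
  have -> : height (sign G) (map (relabel phi1) (chord G1)) (phi2 c.2) =
      height (sign G) (map (relabel phi1) (chord G1)) (phi2 c.1); last by ring.
  have [c1 c2] := pos c cG.
  rewrite /height !big_map; apply: eq_big_seq => d dG; have [d1 d2] := neg d dG.
  by rewrite /= ![sgz (phi2 _ - _)]sgzBC !lt_neg.
have f1 y : {in chord G1, forall c, weight (sign G) (grade G) y (relabel phi1 c) =
    weight (sign G1) (grade G1) y c :> F}.
  by move=> c cG; rewrite /weight w1// g1.
have f2 y : {in chord G2, forall c, weight (sign G) (grade G) y (relabel phi2 c) =
    weight (sign G2) (grade G2) y c :> F}.
  by move=> c cG; rewrite /weight w2// g2.
rewrite /gauss_form (form_perm _ _ pG) form_cat; congr (_ + _).
  by congr (_ + _); exact: form_relabel.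
have lag2 c d : c \in chord G1 -> d \in chord G2 ->
    lag (relabel phi1 c) (relabel phi2 d) = 2.
  move=> cG dG; have [c1 c2] := neg c cG; have [d1 d2] := pos d dG.
  by rewrite /lag /= ![sgz (phi2 _ - _)]sgzBC !lt_neg.
have sum2 y : {in chord G1, forall c, \sum_(d <- map (relabel phi2) (chord G2))
    weight (sign G) (grade G) y d * (lag (relabel phi1 c) d)%:~R = 2 * gauss_W y G2 :> F}.
  move=> c cG; rewrite big_map /gauss_W mulr_sumr; apply: eq_big_seq => d dG.
  by rewrite lag2// f2// mulrC.
have two (u v u' v' : F) : 2 * (u * v - u' * v') = u * (2 * v) - u' * (2 * v') by ring.
rewrite big_map two {1 3}/gauss_W !mulr_suml -sumrB; apply: eq_big_seq => c cG.
by rewrite !sum2// !f1.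
Qed.

End Gauss.

(** * Finiteness of the set of double points *)

Section Calculus.
Variable R : realType.
Implicit Types (V W : normedModType R).

Lemma smooth_differentiable V W (f : V -> W) x : smooth f -> differentiable f x.
Proof. by move=> sf; exact: (sf 1%N).1. Qed.

Lemma smooth_derivable V W (f : V -> W) x v : smooth f -> derivable f x v.
Proof. by move=> sf; apply/diff_derivable/smooth_differentiable. Qed.

Lemma smooth_continuous V W (f : V -> W) : smooth f -> continuous f.
Proof. by move=> sf; exact: (sf 0%N). Qed.

Lemma smooth_derive_continuous V W (f : V -> W) v :
  smooth f -> continuous (fun x => 'D_v f x).
Proof. by move=> sf; exact: ((sf 1%N).2 v). Qed.

Lemma derive_chain V W (U : normedModType R) (f : U -> V) (g : V -> W) x v :
  differentiable f x -> differentiable g (f x) ->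
  'D_v (g \o f) x = 'D_('D_v f x) g (f x).
Proof.
move=> df dg; rewrite deriveE; last exact: differentiable_comp.
by rewrite diff_comp//= -!deriveE.
Qed.

Lemma derive_fst (f : R -> R * R) x : derivable f x 1 ->
  derivable (fun t => (f t).1) x 1 /\ 'D_1 (fun t => (f t).1) x = ('D_1 f x).1.
Proof.
move=> /cvg_ex[l fl].
have c1 : (fun h => h^-1 *: (((fun t => (f t).1) \o shift x) (h *: 1) - (f x).1))
    @ 0^' --> l.1.
  exact: (cvg_comp _ _ fl (cvg_fst (F := nbhs l.1) (G := nbhs l.2))).
split; first by apply/cvg_ex; exists l.1.
by rewrite /derive (cvg_lim _ c1)// (cvg_lim _ fl).
Qed.

Lemma derive_snd (f : R -> R * R) x : derivable f x 1 ->
  derivable (fun t => (f t).2) x 1 /\ 'D_1 (fun t => (f t).2) x = ('D_1 f x).2.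
Proof.
move=> /cvg_ex[l fl].
have c1 : (fun h => h^-1 *: (((fun t => (f t).2) \o shift x) (h *: 1) - (f x).2))
    @ 0^' --> l.2.
  exact: (cvg_comp _ _ fl (cvg_snd (F := nbhs l.1) (G := nbhs l.2))).
split; first by apply/cvg_ex; exists l.2.
by rewrite /derive (cvg_lim _ c1)// (cvg_lim _ fl).
Qed.

Lemma derive_near V (f : R -> V) x (e : R) : derivable f x 1 -> 0 < e ->
  \forall y \near x, `|f y - f x - (y - x) *: 'D_1 f x| <= e * `|y - x|.
Proof.
move=> df e0; have /eqaddoP/(_ e e0) := derivable_nbhs df.
rewrite !near_simpl /= => /nbhs_ballP[d /= d0 H].
apply/nbhs_ballP; exists d => //= y xy.
have /H : ball 0 d (y - x) by rewrite /ball /= sub0r normrN distrC; exact: xy.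
by rewrite /= !fctE /= /shift/= scaler1 subrK opprD addrA.
Qed.

Lemma near_pairP (P : R * R -> Prop) (x y : R) :
  (\forall z \near (x, y), P z) -> exists2 d : R, 0 < d &
  forall s t, `|s - x| < d -> `|t - y| < d -> P (s, t).
Proof.
move=> /nbhs_ballP[d /= d0 H]; exists d => // s t sx ty.
by apply: H; split; rewrite /ball /= distrC.
Qed.

Lemma derive_neq0_inj (f : R -> R) x : (forall t, derivable f t 1) ->
  continuous (fun t => 'D_1 f t) -> 'D_1 f x != 0 ->
  exists2 d : R, 0 < d & forall s t, `|s - x| < d -> `|t - x| < d -> f s = f t -> s = t.
Proof.
move=> df cf f0.
have /nbhs_ballP[d /= d0 H] : \forall t \near x, 'D_1 f t != 0 by exact: cvgr_neq0 (cf x) f0.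
exists d => //; suff W s t : s < t -> `|s - x| < d -> `|t - x| < d -> f s != f t.
  move=> s t sx tx e; have [st|ts|//] := ltgtP s t.
    by have := W s t st sx tx; rewrite e eqxx.
  by have := W t s ts tx sx; rewrite e eqxx.
move=> st sx tx; apply/eqP => e.
have [||c cst] := Rolle st _ _ e.
- by move=> c _; exact: df.
- apply: continuous_subspaceT => c; apply: differentiable_continuous.
  exact/derivable1_diffP.
case=> _ f'c; have := H c; rewrite f'c eqxx.
have/andP[sc ct] : s < c < t by rewrite in_itv in cst.
suff /[swap]/[apply] : ball x d c by [].
by rewrite /ball /= ltr_norml; move: sx tx; rewrite !ltr_norml; lra.
Qed.

Lemma det2_self (v : R * R) : det2 v v = 0.
Proof. by rewrite /det2 mulrC subrr. Qed.

Lemma det2_linear a b (v w x : R * R) : det2 (a *: v + b *: w) x = a * det2 v x + b * det2 w x.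
Proof. by rewrite /det2 /= /GRing.scale /=; ring. Qed.

Lemma det2N (v w : R * R) : det2 w v = - det2 v w.
Proof. by rewrite /det2; ring. Qed.

Lemma det2_bound (v w : R * R) : `|det2 v w| <= 2 * `|v| * `|w|.
Proof.
have v1 : `|v.1| <= `|v| by rewrite prod_normE le_max lexx.
have v2 : `|v.2| <= `|v| by rewrite prod_normE le_max lexx orbT.
have w1 : `|w.1| <= `|w| by rewrite prod_normE le_max lexx.
have w2 : `|w.2| <= `|w| by rewrite prod_normE le_max lexx orbT.
have := ler_pM (normr_ge0 _) (normr_ge0 _) v1 w2.
have := ler_pM (normr_ge0 _) (normr_ge0 _) v2 w1.
rewrite -!normrM /det2; have := ler_normB (v.1 * w.2) (v.2 * w.1); lra.
Qed.

(** With k = 2v + 2w + 1, adding the two bounds gives (a + b) d <= k e, while the last hypothesis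
    gives k e <= (a + b) d / 2. The summand 1 keeps k positive. *)
Lemma small_combination (a b d e v w : R) :
  0 <= a -> 0 <= b -> 0 < d -> 0 <= e -> 0 <= v -> 0 <= w ->
  a * d <= 2 * e * w -> b * d <= 2 * e * v ->
  e <= d / (2 * (2 * v + 2 * w + 1)) * (a + b) -> a = 0 /\ b = 0.
Proof.
move=> a0 b0 d0 e0 v0 w0 ad bd eab.
pose k := 2 * v + 2 * w + 1; have k0 : 0 < k by rewrite /k; lra.
have key : (a + b) * d <= k * e.
  have -> : k * e = 2 * e * w + 2 * e * v + e by rewrite /k; ring.
  by rewrite mulrDl; lra.
have ke : k * e <= (a + b) * d / 2.
  apply: (le_trans (ler_wpM2l (ltW k0) eab)); rewrite -/k le_eqVlt.
  by apply/orP; left; apply/eqP; field; exact: lt0r_neq0.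
have ab0 : (a + b) * d <= 0 by move: key ke; move: ((a + b) * d) (k * e) => x y; lra.
have : a + b <= 0 by rewrite -(pmulr_lle0 _ d0).
by split; lra.
Qed.

(** Cramer's rule: determinants against w and v isolate a and b. For transverse v and w, a
    combination that is small relative to its coefficients is thus trivial. *)
Lemma transverse_small (a b : R) (v w E : R * R) :
  0 < `|det2 v w| -> a *: v + (- b) *: w = E ->
  `|E| <= `|det2 v w| / (2 * (2 * `|v| + 2 * `|w| + 1)) * (`|a| + `|b|) ->
  a = 0 /\ b = 0.
Proof.
move=> det0 eqE bE.
have dw : det2 E w = a * det2 v w by rewrite -eqE det2_linear det2_self mulr0 addr0.
have dv : det2 E v = b * det2 v w.
  by rewrite -eqE det2_linear det2_self mulr0 add0r (det2N v w) mulrNN.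
have ba : `|a| * `|det2 v w| <= 2 * `|E| * `|w|.
  by rewrite -normrM -dw; exact: det2_bound.
have bb : `|b| * `|det2 v w| <= 2 * `|E| * `|v|.
  by rewrite -normrM -dv; exact: det2_bound.
have [/normr0_eq0 a0 /normr0_eq0 b0] := small_combination (normr_ge0 a) (normr_ge0 b)
  det0 (normr_ge0 E) (normr_ge0 v) (normr_ge0 w) ba bb bE.
by [].
Qed.

End Calculus.

Section DoublePoints.
Variables (R : realType) (D : diagram R).

Definition double_points : set (R * R) := [set c | c.1 != c.2 /\ D c.1 = D c.2].

Lemma curve_differentiable t : differentiable D t.
Proof. exact/smooth_differentiable/curve_smooth. Qed.

Lemma curve_derivable t : derivable D t 1.
Proof. exact/smooth_derivable/curve_smooth. Qed.
Arguments curve_derivable : clear implicits.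

(** By immersion one coordinate has nonzero derivative at x, hence near x, where Rolle's theorem
    makes it injective. *)
Lemma curve_locally_inj x : exists2 d : R, 0 < d &
  forall s t, `|s - x| < d -> `|t - x| < d -> D s = D t -> s = t.
Proof.
have cD : continuous (fun t => 'D_1 D t).
  exact/smooth_derive_continuous/curve_smooth.
have d1 t := derive_fst (curve_derivable t).
have d2 t := derive_snd (curve_derivable t).
have c1 : continuous (fun t : R => 'D_1 (fun u : R => (D u).1) t).
  have -> : (fun t : R => 'D_1 (fun u : R => (D u).1) t) = (fun t : R => ('D_1 D t).1).
    by apply/funext => t; exact: (d1 t).2.
  by move=> t; apply: (cvg_comp _ _ (cD t)); exact: cvg_fst.
have c2 : continuous (fun t : R => 'D_1 (fun u : R => (D u).2) t).
  have -> : (fun t : R => 'D_1 (fun u : R => (D u).2) t) = (fun t : R => ('D_1 D t).2).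
    by apply/funext => t; exact: (d2 t).2.
  by move=> t; apply: (cvg_comp _ _ (cD t)); exact: cvg_snd.
have [e|e] := eqVneq ('D_1 D x).1 0; last first.
  have [|||d d0 H] := @derive_neq0_inj R (fun t => (D t).1) x.
  - by move=> t; exact: (d1 t).1.
  - exact: c1.
  - by rewrite (d1 _).2.
  by exists d => // s t sx tx e'; apply: (H s t) => //; rewrite e'.
have [|||d d0 H] := @derive_neq0_inj R (fun t => (D t).2) x.
- by move=> t; exact: (d2 t).1.
- exact: c2.
- rewrite (d2 _).2; apply: contra (curve_immersion D x) => /eqP e'.
  by rewrite [X in X == _]surjective_pairing e e'.
by exists d => // s t sx tx e'; apply: (H s t) => //; rewrite e'.
Qed.

(** The pair (s0, t0) is arbitrary, so that the lemma applies to any cluster point: local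
    injectivity settles the diagonal, continuity the pairs with distinct images, and transversality
    the double points. *)
Lemma double_point_isolated s0 t0 : exists2 d : R, 0 < d & forall s t,
  `|s - s0| < d -> `|t - t0| < d -> double_points (s, t) -> (s, t) = (s0, t0).
Proof.
have [<-{t0}|st0] := eqVneq s0 t0.
  have [d d0 H] := curve_locally_inj s0; exists d => // s t ss tt [/= /eqP st e].
  by have := H s t ss tt e.
have [e|ne] := eqVneq (D s0) (D t0); last first.
  have cD : continuous D := @curve_continuous R D.
  have cv : (fun z : R * R => D z.1 - D z.2) @ (s0, t0) --> D s0 - D t0.
    apply: cvgB.
      apply: (@continuous_comp _ _ _ (fst : R * R -> R) D (s0, t0)); last exact: cD.
      exact: cvg_fst.
    apply: (@continuous_comp _ _ _ (snd : R * R -> R) D (s0, t0)); last exact: cD.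
    exact: cvg_snd.
  have : \forall z \near (s0, t0), D z.1 - D z.2 != 0.
    by apply: cvgr_neq0 cv _; rewrite subr_eq0.
  move=> /near_pairP[d d0 H]; exists d => // s t ss tt [_ /= e].
  by have := H s t ss tt; rewrite /= e subrr eqxx.
set v := 'D_1 D s0; set w := 'D_1 D t0.
have det0 : 0 < `|det2 v w| by rewrite normr_gt0; exact: curve_transverse.
pose k := 2 * `|v| + 2 * `|w| + 1.
have k0 : 0 < k by rewrite ltr_wpDl// addr_ge0// mulr_ge0.
pose eps := `|det2 v w| / (2 * k).
have eps0 : 0 < eps by rewrite divr_gt0// mulr_gt0.
have /nbhs_ballP[d1 /= d10 H1] := derive_near (curve_derivable s0) eps0.
have /nbhs_ballP[d2 /= d20 H2] := derive_near (curve_derivable t0) eps0.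
exists (Num.min d1 d2); first by rewrite lt_min d10.
move=> s t; rewrite !lt_min => /andP[ss _] /andP[_ tt] [/= st est].
have := H1 s; rewrite /ball /= distrC => /(_ ss); rewrite -/v => b1.
have := H2 t; rewrite /ball /= distrC => /(_ tt); rewrite -/w => b2.
set E1 := D s - _ - _ in b1; set E2 := D t - _ - _ in b2.
(* Subtracting the first-order expansions at s0 and t0 gives a v - b w = E, where E is the
   difference of the remainders. *)
pose a := s - s0; pose b := t - t0; pose E := E2 - E1.
have eqE : a *: v + (- b) *: w = E.
  rewrite /E /E1 /E2 est e -/a -/b scaleNr opprB.
  by move: (a *: v) (b *: w) (D t - D t0) => x y z; rewrite [RHS]addrC addrA subrK.
have bE : `|E| <= eps * (`|a| + `|b|).
  by rewrite mulrDr; apply: le_trans (ler_normB _ _) _; rewrite addrC lerD.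
have [a0 b0] := transverse_small det0 eqE bE.
move/eqP: a0; move/eqP: b0; rewrite !subr_eq0.
by move=> /eqP -> /eqP ->.
Qed.

Lemma double_points_finite : finite_set double_points.
Proof.
have [r1 std strip] := radiusP D; set r := radius D in r1 std strip.
have bnd s t : double_points (s, t) -> - r <= s <= r.
  move=> [/= /eqP st e]; rewrite -ler_norml; have [//|rs] := leP `|s| r.
  have es : D s = (s, 0) by apply: std; lra.
  have [tr|rt] := ltP `|t| r; last by case: st; move: e; rewrite es std; [case|lra].
  by have := strip t tr; rewrite -e es /=; lra.
have sub : double_points `<=` `[- r, r] `*` `[- r, r].
  move=> [s t] dst; split; rewrite /= in_itv /=; first exact: bnd dst.
  by apply: (bnd t s); case: dst => /= st e; rewrite /double_points /= eq_sym.
have cK : compact (`[- r, r] `*` `[- r, r] : set (R * R)).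
  by apply: compact_setX; exact: segment_compact.
apply: contrapT => infA.
(* The cofinite filter on the double points: were they infinitely many, it would be proper and
   cluster at some z of the compact square, against the isolation of double points around z. *)
pose F : set_system (R * R) := [set P | finite_set (double_points `\` P)].
have FF : ProperFilter F.
  split; first by rewrite /F /= setD0.
  split; first by rewrite /F /= setDT.
    move=> P Q fP fQ; suff : finite_set (double_points `\` (P `&` Q)) by [].
    by rewrite setDE setCI setIUr finite_setU; split.
  by move=> P Q PQ; apply: sub_finite_set => c [Ac nQ]; split=> // /PQ.
have [|z [_ zF]] := cK F FF; first by rewrite /F /= (_ : _ `\` _ = set0)// setD_eq0.
have [d d0 H] := double_point_isolated z.1 z.2.
have FA : F (double_points `\ z).
  apply: (@sub_finite_set _ _ [set z]); last exact: finite_set1.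
  by move=> c [Ac nc]; apply: contrapT => cz; apply: nc.
have [[s t] [[Ast /= nz] [zs zt]]] := zF _ _ FA (nbhsx_ballx z d d0).
by apply: nz; rewrite [z]surjective_pairing; apply: H => //; rewrite distrC.
Qed.

End DoublePoints.
Arguments curve_derivable [R] D t.

(** * The Gauss diagram of a long virtual knot diagram *)

Section GaussOfDiagram.
Variables (R : realType) (D : diagram R).

Lemma over_double_points c : over D c -> double_points D c.
Proof. by case: c => o u; exact: over_double. Qed.

Lemma over_finite : finite_set (over D).
Proof.
by apply: (sub_finite_set _ (double_points_finite D)) => c; exact: over_double_points.
Qed.

Definition chords : seq (R * R) := finmap.enum_fset (fset_set (over D)).

Lemma mem_chords c : c \in chords <-> over D c.
Proof. by rewrite /chords in_fset_set ?inE//; exact: over_finite. Qed.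

Lemma chords_uniq : uniq chords.
Proof. exact: finmap.fset_uniq. Qed.

Lemma chords_disjoint c d : over D c -> over D d -> c != d ->
  [/\ d.1 != c.1, d.1 != c.2, d.2 != c.1 & d.2 != c.2].
Proof.
case: c d => [p u] [p' u'] oc od /eqP cd.
have [/= /eqP pu e] := over_double oc; have [/= /eqP pu' e'] := over_double od.
split; apply/eqP => /= E; subst.
- have [E|[E|E]] := curve_double (esym e) e'; [exact: pu|exact: pu'|].
  by apply: cd; rewrite E.
- have [E|[E|E]] := curve_double e e'; [exact: pu|exact: pu'|].
  by subst; exact: over_asym oc od.
- have [E|[E|E]] := curve_double (esym e) (esym e'); [exact: pu|exact: pu'|].
  by subst; exact: over_asym oc od.
- have [E|[E|E]] := curve_double e (esym e'); [exact: pu|exact: pu'|].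
  by apply: cd; rewrite E.
Qed.

(** The factor 1 or -1 is also the sign that W puts before the index of an EO or EU crossing; in
    [signed_indexP] the two multiply to 1. *)
Lemma between_sgz (c : R * R) x : x != c.1 -> x != c.2 ->
  2 * (between c x)%:R =
  (if c.1 < c.2 then 1 else -1) * (sgz (c.2 - x) - sgz (c.1 - x)) :> int.
Proof.
case: c => p u /= xo xu; rewrite /between /=.
have s y : x != y -> sgz (y - x) = if x < y then 1 else -1.
  move=> xy; case: ifP => h; first by rewrite gtr0_sgz// subr_gt0.
  by rewrite ltr0_sgz// subr_lt0 lt_neqAle eq_sym xy leNgt h.
rewrite !s//; case: (ltP p u) => h.
  case: (ltgtP x p) xo => // xo _ /=; first by rewrite (lt_trans xo h).
  by case: (x < u).
case: (ltgtP x u) xu => // xu _ /=; first by rewrite (lt_le_trans xu h).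
by case: (x < p).
Qed.

Lemma double_sign_diff (e w x y x1 x2 y1 y2 : int) : e ^+ 2 = 1 ->
  2 * x = e * (x1 - x2) -> 2 * y = e * (y1 - y2) ->
  2 * e * (w * x - w * y) = w * (x1 - y1) - w * (x2 - y2).
Proof.
move=> ee hx hy; have -> : 2 * e * (w * x - w * y) = e * w * (2 * x - 2 * y) by ring.
rewrite hx hy; transitivity (e ^+ 2 * (w * (x1 - y1) - w * (x2 - y2))); first by ring.
by rewrite ee mul1r.
Qed.

Definition signed_index (c : R * R) : int :=
  if is_EO c then index D c else - index D c.

Lemma signed_indexP : {in chords, forall c, 2 * signed_index c =
  height (writhe D) chords c.2 - height (writhe D) chords c.1}.
Proof.
move=> c cD; have oc := (mem_chords c).1 cD.
have -> : signed_index c = (if c.1 < c.2 then 1 else -1) * index D c.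
  by rewrite /signed_index /is_EO; case: ifP; rewrite ?mul1r ?mulN1r.
rewrite /index fsbig_finite; last exact: over_finite.
rewrite -/chords /height.
rewrite [RHS](_ : _ = \sum_(d <- chords) (writhe D d * (sgz (c.2 - d.1) - sgz (c.2 - d.2))
  - writhe D d * (sgz (c.1 - d.1) - sgz (c.1 - d.2)))); last exact/esym/sumrB.
rewrite mulrA mulr_sumr; apply: eq_big_seq => d /mem_chords od.
(* The chord c is not counted in its own index, and in the difference of heights its two half
   contributions cancel. *)
have [<-|cd] := eqVneq c d.
  have b1 : between c c.1 = false.
    by rewrite /between gt_min lt_max !ltxx /=; case: ltgtP.
  have b2 : between c c.2 = false.
    by rewrite /between gt_min lt_max !ltxx !orbF; case: ltgtP.
  rewrite b1 b2.
  by rewrite !subrr mulr0 !sgz0 (sgzBC c.1 c.2); ring.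
have [d1 d2 d3 d4] := chords_disjoint oc od cd.
apply: double_sign_diff (between_sgz d1 d2) (between_sgz d3 d4).
by case: ifP.
Qed.

Definition gauss_of : gauss R := Gauss signed_indexP.

Lemma diagram_W_gauss (F : fieldType) (x : F) : diagram_W D x = gauss_W x gauss_of.
Proof. by rewrite /diagram_W fsbig_finite//; exact: over_finite. Qed.

Lemma writheN o u : writhe D (u, o) = - writhe D (o, u).
Proof. by rewrite /writhe [in LHS]det2N sgzN. Qed.

End GaussOfDiagram.

(** * Gauss diagrams of products *)

Section Product.
Variable R : realType.
Implicit Types E D : diagram R.

Lemma eq_writhe E D (c d : R * R) : 'D_1 E c.1 = 'D_1 D d.1 ->
  'D_1 E c.2 = 'D_1 D d.2 -> writhe E c = writhe D d.
Proof. by rewrite /writhe => -> ->. Qed.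

Lemma chords_perm D s : uniq s -> (forall c, c \in s <-> over D c) ->
  perm_eq (chords D) s.
Proof.
move=> us sD; apply: uniq_perm => //; first exact: chords_uniq.
by move=> c; apply/idP/idP; rewrite mem_chords sD.
Qed.

(* Covers both D1 . D2 and its crossing change EO(D1 . D2), which is not literally
   the product of EO(D1) and EO(D2): the radii chosen for D1 and EO(D1) may
   differ. *)
Definition juxtaposition E D1 D2 : Prop := exists r1 r2 : R, [/\
  forall c, over E c <->
    [/\ c.1 < 0, c.2 < 0 & over D1 (c.1 + r1, c.2 + r1)] \/
    [/\ 0 <= c.1, 0 <= c.2 & over D2 (c.1 - r2, c.2 - r2)],
  forall t, t < 0 -> 'D_1 E t = 'D_1 D1 (t + r1),
  forall t, 0 <= t -> 'D_1 E t = 'D_1 D2 (t - r2),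
  forall c, over D1 c -> c.1 < r1 /\ c.2 < r1
& forall c, over D2 c -> - r2 <= c.1 /\ - r2 <= c.2 ].

Lemma juxtaposition_form E D1 D2 (F : fieldType) (x : F) : juxtaposition E D1 D2 ->
  gauss_form x (gauss_of E) = gauss_form x (gauss_of D1) + gauss_form x (gauss_of D2) +
    2 * (diagram_W D1 x * diagram_W D2 x^-1 - diagram_W D1 x^-1 * diagram_W D2 x).
Proof.
move=> [r1 [r2 [oE E1 E2 b1 b2]]]; rewrite !diagram_W_gauss.
apply: (@gauss_product _ _ _ _ (fun t => t - r1) (fun t => t + r2)).
- by move=> u v; rewrite opprB addrA subrK.
- by move=> u v; rewrite opprD addrACA subrr addr0.
- apply: chords_perm.
    rewrite cat_uniq !map_inj_uniq ?chords_uniq; first last.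
    + by move=> [a b] [c d] [/subIr-> /subIr->].
    + by move=> [a b] [c d] [/addIr-> /addIr->].
    rewrite andbT /=; apply/hasPn => _ /mapP[c /mem_chords cD ->].
    apply/negP => /mapP[d /mem_chords dD] [e _].
    have [d1 _] := b1 d dD; have [c1 _] := b2 c cD.
    by move: e; apply/eqP; rewrite gt_eqF//; lra.
  move=> c; rewrite mem_cat oE; split=> [/orP[]|[[c1 c2 oc]|[c1 c2 oc]]].
  + move=> /mapP[d /mem_chords dD ->]; left; rewrite /= !subrK -surjective_pairing.
    by have [? ?] := b1 d dD; split=> //; rewrite subr_lt0.
  + move=> /mapP[d /mem_chords dD ->]; right; rewrite /= !addrK -surjective_pairing.
    by have [? ?] := b2 d dD; split=> //; rewrite -lerBlDr sub0r.
  + apply/orP; left; apply/mapP; exists (c.1 + r1, c.2 + r1); first exact/mem_chords.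
    by rewrite /relabel /= !addrK -surjective_pairing.
  + apply/orP; right; apply/mapP; exists (c.1 - r2, c.2 - r2); first exact/mem_chords.
    by rewrite /relabel /= !subrK -surjective_pairing.
- move=> c /mem_chords /b1[c1 c2].
  have c0 v : v < r1 -> 'D_1 E (v - r1) = 'D_1 D1 v.
    by move=> rv; rewrite E1 ?subrK ?subr_lt0.
  exact: (@eq_writhe E D1 (relabel _ c) c) (c0 _ c1) (c0 _ c2).
- move=> c /mem_chords /b2[c1 c2].
  have c0 v : - r2 <= v -> 'D_1 E (v + r2) = 'D_1 D2 v.
    by move=> rv; rewrite E2 ?addrK -?lerBlDr ?sub0r.
  exact: (@eq_writhe E D2 (relabel _ c) c) (c0 _ c1) (c0 _ c2).
- by move=> c /mem_chords /b1[c1 c2]; rewrite !subr_lt0.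
- by move=> c /mem_chords /b2[c1 c2]; rewrite -!lerBlDr !sub0r.
Qed.

(** Outside the radius r the curve runs injectively along the axis with |x| >= r, and inside it
    stays in the strip |x| < r; a parameter outside is therefore alone over its image. *)
Lemma double_point_radius D c : double_points D c ->
  [/\ `|c.1| < radius D & `|c.2| < radius D].
Proof.
have [r1 std strip] := radiusP D; set r := radius D in r1 std strip *.
suff W s t : double_points D (s, t) -> `|s| < r.
  case: c => s t dst; split; first exact: W dst.
  by apply: (W t s); case: dst => /= st e; rewrite /double_points /= eq_sym.
move=> [/= /eqP st e]; have [//|rs] := ltP `|s| r.
have r1r : r - 1 <= r by rewrite gerBl.
have es : D s = (s, 0) by apply/std/(le_trans r1r).
have [tr|rt] := ltP `|t| r.
  by have := strip t tr; rewrite -e es /= ltNge rs.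
by case: st; move: e; rewrite es std; [case|exact: le_trans rt].
Qed.

Lemma product_juxtaposition D1 D2 :
  juxtaposition (diagram_product D1 D2) D1 D2.
Proof.
exists (radius D1), (radius D2); split.
- by [].
- by move=> t t0; exact: product_left_derive.
- by move=> t t0; exact: product_right_derive.
- move=> c /over_double_points/double_point_radius[/ltr_normlW ? /ltr_normlW ?].
  by split.
- move=> c /over_double_points/double_point_radius[].
  by rewrite !ltr_norml => /andP[/ltW ? _] /andP[/ltW ? _].
Qed.

Lemma product_EO_juxtaposition D1 D2 :
  juxtaposition (diagram_EO (diagram_product D1 D2)) (diagram_EO D1) (diagram_EO D2).
Proof.
exists (radius D1), (radius D2); split.
- move=> [p u]; rewrite /= /EO_over /is_EO /= !ltrD2r.
  split.
    move=> [[[[? ? ?]|[? ? ?]] ?]|[[[? ? ?]|[? ? ?]] ?]].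
    + by left; split=> //; left.
    + by right; split=> //; left.
    + by left; split=> //; right.
    + by right; split=> //; right.
  move=> [[? ? [[? ?]|[? ?]]]|[? ? [[? ?]|[? ?]]]].
  + by left; split=> //; left.
  + by right; split=> //; left.
  + by left; split=> //; right.
  + by right; split=> //; right.
- by move=> t t0; exact: product_left_derive.
- by move=> t t0; exact: product_right_derive.
- move=> c /(@over_double_points _ (diagram_EO D1))/(@double_point_radius D1)[].
  by move=> /ltr_normlW ? /ltr_normlW ?.
- move=> c /(@over_double_points _ (diagram_EO D2))/(@double_point_radius D2)[].
  by rewrite !ltr_norml => /andP[/ltW ? _] /andP[/ltW ? _].
Qed.

End Product.

(** * Arcs running along graphs *)

Section Monotone.
Variable R : realType.
Implicit Types f : R -> R.

Lemma derivable_continuous f : (forall t, derivable f t 1) -> continuous f.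
Proof. by move=> df t; apply/differentiable_continuous/derivable1_diffP. Qed.

Lemma sgz_lt (x y u v : R) : (x < y) = (u < v) -> (y < x) = (v < u) ->
  sgz (x - y) = sgz (u - v).
Proof.
move=> e1 e2; have [h|h|h] := ltgtP x y.
- by rewrite !ltr0_sgz// subr_lt0// -e1.
- by rewrite !gtr0_sgz// subr_gt0// -e2.
- have -> : u = v by apply/eqP; rewrite eq_le !leNgt -e1 -e2 h ltxx.
  by rewrite h !subrr.
Qed.

(** Rolle's theorem gives injectivity, hence monotonicity, which controls the sign of the derivative
    only weakly; nonvanishing makes it strict. The open interval matches [strand_derive], which
    holds in the interior. *)
Lemma monotone_of_derive_neq0 f (a b : R) :
  a < b -> (forall t, derivable f t 1) ->
  {in `]a, b[, forall t, 'D_1 f t != 0} ->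
  exists e : int, [/\ e = 1 \/ e = -1,
    {in `[a, b] &, forall s t, sgz (s - t) = e * sgz (f s - f t)}
  & {in `]a, b[, forall t, sgz ('D_1 f t) = e}].
Proof.
move=> ab df f0.
have cf : continuous f by exact: derivable_continuous.
have inj : {in `[a, b] &, injective f}.
  suff W s t : s < t -> s \in `[a, b] -> t \in `[a, b] -> f s != f t.
    move=> s t sI tI e; have [st|ts|//] := ltgtP s t.
      by have := W s t st sI tI; rewrite e eqxx.
    by have := W t s ts tI sI; rewrite e eqxx.
  move=> st; rewrite !in_itv /= => /andP[as_ _] /andP[_ tb].
  apply/eqP => e; have [||c cst [_ dc]] := Rolle st _ _ e.
  - by move=> c _; exact: df.
  - exact: continuous_subspaceT.
  have := f0 c; rewrite dc eqxx => H; suff /H : c \in `]a, b[ by [].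
  move: cst; rewrite !in_itv /= => /andP[sc ct].
  by rewrite (le_lt_trans as_ sc) (lt_le_trans ct tb).
have cw : {within [set` `[a, b]], continuous f} by exact: continuous_subspaceT.
case: (itv_continuous_inj_mono cw inj) => mono.
  exists 1; split; [by left| |].
    by move=> s t sI tI; rewrite mul1r; apply: sgz_lt; rewrite (leW_mono_in (le_mono_in mono))//.
  move=> t tI; apply: gtr0_sgz; rewrite lt0r f0//=.
  rewrite -derive1E; apply: (@incr_derive1_ge0_itv _ f true false a b) tI => [u _|]; [exact: df|exact: mono].
exists (-1); split; [by right| |].
  move=> s t sI tI; rewrite mulN1r -sgzN opprB; apply: sgz_lt;
    rewrite (leW_nmono_in (le_nmono_in mono))//.
move=> t tI; apply: ltr0_sgz; rewrite lt_neqAle f0//=.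
rewrite -derive1E; apply: (@decr_derive1_le0_itv _ f true false a b) tI => [u _|]; [exact: df|exact: mono].
Qed.

End Monotone.

Section Strand.
Variables (R : realType) (D : diagram R).

Definition abscissa (t : R) : R := (D t).1.

Lemma abscissa_derivable t : derivable abscissa t 1.
Proof. exact: (derive_fst (curve_derivable D t)).1. Qed.
Arguments abscissa_derivable : clear implicits.

Lemma strand_derive a b f t : graph_strand D a b f -> t \in `]a, b[ ->
  'D_1 D t = ('D_1 abscissa t) *: (1, 'D_1 f (abscissa t)).
Proof.
move=> [ab sf gf _] tI.
have [d1 e1] := derive_fst (curve_derivable D t).
have [d2 e2] := derive_snd (curve_derivable D t).
rewrite [LHS]surjective_pairing -e1 -e2; congr pair; first by rewrite [RHS]mulr1.
have -> : 'D_1 (fun t => (D t).2) t = 'D_1 (f \o abscissa) t.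
  apply: near_eq_derive; near=> y; apply: gf.
  have : y \in `]a, b[ by near: y; exact: near_in_itvoo.
  by rewrite !in_itv /= => /andP[/ltW -> /ltW ->].
have df : derivable f (abscissa t) 1 by exact: smooth_derivable.
have := derive1_comp (abscissa_derivable t) df.
by rewrite !derive1E => ->; rewrite mulrC.
Unshelve. all: by end_near. Qed.

(** The velocity along a graph is a multiple of (1, f'), so immersion forbids a stationary abscissa.
    The sign e is the direction in which the strand crosses the box. *)
Lemma strand_abscissa a b f : graph_strand D a b f ->
  exists e : int, [/\ e = 1 \/ e = -1,
    {in `[a, b] &, forall s t, sgz (s - t) = e * sgz (abscissa s - abscissa t)},
    {in `]a, b[, forall t, sgz ('D_1 abscissa t) = e},
    (D a).1 = - e%:~R & (D b).1 = e%:~R].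
Proof.
move=> gs; have [ab sf gf ends] := gs.
have [|e [e1 mono der]] := monotone_of_derive_neq0 ab abscissa_derivable.
  move=> t tI; apply: contra (curve_immersion D t) => /eqP X0.
  by rewrite (strand_derive gs tI) X0 scale0r.
have s1 : sgz (-1 - 1 : R) = -1 by rewrite ltr0_sgz//; lra.
have s2 : sgz (1 - -1 : R) = 1 by rewrite gtr0_sgz//; lra.
have aI : a \in `[a, b] by rewrite in_itv /= lexx ltW.
have bI : b \in `[a, b] by rewrite in_itv /= lexx ltW.
have := mono a b aI bI; rewrite ltr0_sgz ?subr_lt0// /abscissa => key.
suff [Da Db] : (D a).1 = - e%:~R /\ (D b).1 = e%:~R by exists e.
by move: key; case: e1 => ->; case: ends => -[-> ->]; rewrite ?s1 ?s2 ?opprK.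
Qed.

Lemma strand_bounds a b f t : graph_strand D a b f -> t \in `[a, b] ->
  -1 <= abscissa t <= 1.
Proof.
move=> gs tI; have [e [e1 mono _ Da Db]] := strand_abscissa gs.
have ab : a < b by case: gs.
have /andP[at_ tb] : a <= t <= b by move: tI; rewrite in_itv.
have aI : a \in `[a, b] by rewrite in_itv /= lexx ltW.
have bI : b \in `[a, b] by rewrite in_itv /= lexx ltW.
have := mono t a tI aI; have := mono b t bI tI.
rewrite /abscissa Da Db.
have sge (x y : R) : x <= y -> 0 <= sgz (y - x) by rewrite sgz_ge0 subr_ge0.
have := sge _ _ at_; have := sge _ _ tb => + + h1 h2; rewrite h1 h2 => {h1 h2}.
by case: e1 => -> /=; rewrite ?mul1r ?mulN1r ?oppr_ge0 ?sgz_ge0 ?sgz_le0; lra.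
Qed.

Lemma strand_onto a b f x : graph_strand D a b f -> -1 <= x <= 1 ->
  exists2 t, t \in `[a, b] & abscissa t = x.
Proof.
move=> gs /andP[x1 x2]; have [ab _ _ ends] := gs.
have cX : {within `[a, b], continuous abscissa}.
  by apply/continuous_subspaceT/derivable_continuous/abscissa_derivable.
apply: (IVT (ltW ab) cX); rewrite /abscissa.
by case: ends => -[-> ->]; rewrite ge_min le_max x1 x2 ?orbT.
Qed.

Lemma strand_inj a b f s t : graph_strand D a b f -> s \in `[a, b] -> t \in `[a, b] ->
  abscissa s = abscissa t -> s = t.
Proof.
move=> gs sI tI e; have [d [_ mono _ _ _]] := strand_abscissa gs.
have := mono s t sI tI; rewrite e subrr sgz0 mulr0 => /eqP.
by rewrite sgz_eq0 subr_eq0 => /eqP.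
Qed.

Lemma strand_interior a b f t : graph_strand D a b f -> t \in `[a, b] ->
  `|abscissa t| < 1 -> t \in `]a, b[.
Proof.
move=> gs tI t1; have [_ _ _ ends] := gs; move: tI; rewrite !in_itv /= => /andP[at_ tb].
rewrite !lt_neqAle at_ tb !andbT.
have na : `|abscissa a| = 1.
  by rewrite /abscissa; case: ends => -[-> _]; rewrite ?normrN1 ?normr1.
have nb : `|abscissa b| = 1.
  by rewrite /abscissa; case: ends => -[_ ->]; rewrite ?normrN1 ?normr1.
apply/andP; split; apply/eqP => e.
  by move: t1; rewrite -e na ltxx.
by move: t1; rewrite e nb ltxx.
Qed.

End Strand.
Arguments abscissa_derivable [R] D t.

(** det2 of (1, f') and (1, h') is h' - f': the writhe is determined by the two directions of travel
    and the order of the slopes. *)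
Lemma strand_det (R : realType) (D : diagram R) a b c d f h s t :
  graph_strand D a b f -> graph_strand D c d h ->
  s \in `]a, b[ -> t \in `]c, d[ -> D s = D t ->
  writhe D (s, t) = sgz ('D_1 (abscissa D) s) * sgz ('D_1 (abscissa D) t) *
    sgz ('D_1 h (abscissa D s) - 'D_1 f (abscissa D s)).
Proof.
move=> gs ht sI tI e; rewrite /writhe (strand_derive gs sI) (strand_derive ht tI).
rewrite -!sgzM; have -> : abscissa D t = abscissa D s by rewrite /abscissa e.
by congr sgz; rewrite /det2 /= /GRing.scale /=; ring.
Qed.

(** * Reidemeister move I *)

Section AgreeOff.
Variable R : realType.
Implicit Types D : diagram R.

Lemma not_itv_lt (a b t : R) : t \notin `[a, b] -> t < a \/ b < t.
Proof.
by rewrite in_itv /= negb_and -!ltNge => /orP[]; [left|right].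
Qed.

Lemma agree_off_derive D D' a b t : agree_off D D' a b -> t \notin `[a, b] ->
  'D_1 D t = 'D_1 D' t.
Proof.
move=> [_ eD _] /not_itv_lt[ta|bt]; apply: near_eq_derive; near=> x; apply: eD.
  have xa : x < a by near: x; exact: lt_nbhsl.
  by rewrite in_itv /= leNgt xa.
have xb : b < x by near: x; exact: lt_nbhsr.
by rewrite in_itv /= andbC leNgt xb.
Unshelve. all: by end_near. Qed.

Lemma eq_at_limit (f g : R -> R * R) x : continuous f -> continuous g ->
  (forall d, 0 < d -> exists2 t, `|x - t| < d & f t = g t) -> f x = g x.
Proof.
move=> cf cg H; apply/eqP; rewrite -subr_eq0; apply: contrapT => /negP ne.
have cfg : f t - g t @[t --> x] --> f x - g x by exact: cvgB (cf x) (cg x).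
have /nbhs_ballP[d /= d0 B] : \forall t \near x, f t - g t != 0.
  exact: cvgr_neq0 cfg ne.
by have [t xt e] := H d d0; have := B t xt; rewrite /= e subrr eqxx.
Qed.

(** The hypothesis is silent at a and b, and continuity fills them in. This ties the new arc to the
    ends of the old one. *)
Lemma agree_off_ends D D' a b : agree_off D D' a b -> D a = D' a /\ D b = D' b.
Proof.
move=> [ab eD _]; split; apply: eq_at_limit; try exact: curve_continuous.
  move=> d d0; exists (a - d / 2).
    by rewrite opprB addrC subrK ger0_norm; lra.
  by apply: eD; rewrite in_itv /= leNgt gtrBl divr_gt0.
move=> d d0; exists (b + d / 2).
  by rewrite opprD addrA subrr sub0r normrN ger0_norm; lra.
by apply: eD; rewrite in_itv /= andbC leNgt ltrDl divr_gt0.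
Qed.

(** J is the preimage of the box, so two parameters with the same image are both in J or both
    outside it, and no chord joins the inside to the outside. C consists of the outside chords,
    common to both diagrams; each move lists its own inside chords as L. *)
Lemma box_chords D D' a b (J : set R) : agree_off D D' a b ->
  `[a, b]%classic `<=` J -> D @^-1` @box R = J -> D' @^-1` @box R = J ->
  exists C, [/\
    forall L, uniq L -> (forall c, c \in L <-> over D c /\ J c.1) ->
      perm_eq (chords D) (C ++ L),
    forall L, uniq L -> (forall c, c \in L <-> over D' c /\ J c.1) ->
      perm_eq (chords D') (C ++ L),
    {in C, writhe D =1 writhe D'}
  & {in C, forall c, ~ J c.1 /\ ~ J c.2}].
Proof.
move=> ag abJ DJ D'J; have [ab eD eo] := ag.
have J2 (E : diagram R) (EJ : E @^-1` @box R = J) c : over E c -> J c.2 <-> J c.1.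
  by case: c => p u /over_double[_ e]; rewrite -EJ /= e.
have nJ t : ~ J t -> t \notin `[a, b].
  by move=> nJt; apply/negP => tI; apply: nJt; exact: abJ.
have oo c : ~ J c.1 -> over D c <-> over D' c.
  case: c => p u /= Jp; split=> opu.
    by apply/eo => //; apply: nJ => //; move/(J2 _ DJ _ opu).
  by apply/eo => //; apply: nJ => //; move/(J2 _ D'J _ opu).
pose C := [seq c <- chords D | `[< ~ J c.1 >]].
have memC c : c \in C <-> over D c /\ ~ J c.1.
  rewrite /C mem_filter; split=> [/andP[/asboolP ? /mem_chords]|[? ?]] //.
  by apply/andP; split; [exact/asboolP|exact/mem_chords].
have uC L (E : diagram R) : uniq L -> (forall c, c \in L <-> over E c /\ J c.1) -> uniq (C ++ L).
  move=> uL mL; rewrite cat_uniq uL filter_uniq ?chords_uniq ?andbT//.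
  by apply/hasPn => c /mL[_ Jc]; apply/negP => /memC[].
exists C; split.
- move=> L uL mL; apply: chords_perm; first exact: uC mL.
  move=> c; rewrite mem_cat; split=> [/orP[/memC[]|/mL[]]//|oc].
  by have [Jc|nJc] := pselect (J c.1); apply/orP; [right; apply/mL|left; apply/memC].
- move=> L uL mL; apply: chords_perm; first exact: uC mL.
  move=> c; rewrite mem_cat; split.
    by move=> /orP[/memC[oc nJc]|/mL[]//]; exact/(oo c nJc).
  move=> oc; have [Jc|nJc] := pselect (J c.1); apply/orP; [right; exact/mL|left].
  by apply/memC; split=> //; apply/oo.
- move=> c /memC[oc nJc]; have nJ2 : ~ J c.2 by move/(J2 _ DJ _ oc).
  by apply: eq_writhe; apply: agree_off_derive ag _; exact: nJ.
- by move=> c /memC[oc nJc]; split=> //; move/(J2 _ DJ _ oc).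
Qed.

End AgreeOff.

Section Move1.
Variable R : realType.
Implicit Types D : diagram R.

Lemma move1_invariants D D' : move1 D D' ->
  same_invariants (gauss_of D) (gauss_of D').
Proof.
move=> [a [b [ag DJ D'J inj [s0 [t0 [/andP[as0 st0] t0b e0 only]]]]]].
have [C [pD pD' wC offC]] := box_chords ag (@subset_refl _ _) DJ D'J.
have offI : off `[a, b] C.
  by move=> c /offC[c1 c2]; split; apply/negP => cI; [apply: c1|apply: c2].
have J2 (E : diagram R) (EJ : E @^-1` @box R = `[a, b]%classic) p u : over E (p, u) ->
    p \in `[a, b] -> u \in `[a, b].
  move=> /over_double[_ e] pI; have : (E @^-1` @box R) u by rewrite /= -e -[_ _]/((E @^-1` @box R) p) EJ.
  by rewrite EJ.
have pD0 : perm_eq (chords D) C.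
  rewrite -[C]cats0; apply: pD => // -[p u]; split=> // -[opu /= pI].
  have [/eqP pu e] := over_double opu.
  by case: pu; apply: inj e => //; exact: J2 opu pI.
have s0I : s0 \in `[a, b] by rewrite in_itv /= as0 (le_trans (ltW st0)).
have t0I : t0 \in `[a, b] by rewrite in_itv /= t0b (le_trans as0 (ltW st0)).
have memD' c : over D' c -> c.1 \in `[a, b] -> c = (s0, t0) \/ c = (t0, s0).
  case: c => p u opu /= pI; have uI := J2 _ D'J _ _ opu pI.
  have [pu e] := over_double opu; move: pI uI; rewrite !in_itv /= => /andP[ap pb] /andP[au ub].
  have [lt|lt|E] := ltgtP p u; last by move: pu; rewrite E eqxx.
    have apu : a <= p < u by rewrite ap.
    by left; have [-> ->] := only p u apu ub e.
  have aup : a <= u < p by rewrite au.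
  by right; have [-> ->] := only u p aup pb (esym e).
have isolated k : over D' k -> k.1 \in `[a, b] -> k.2 \in `[a, b] ->
    ~ over D' (k.2, k.1) -> (forall c, c = (s0, t0) \/ c = (t0, s0) -> c = k \/ c = (k.2, k.1)) ->
    same_invariants (gauss_of D) (gauss_of D').
  move=> ok k1 k2 nok only'; apply: (@isolated_chord R `[a, b] (gauss_of D) (gauss_of D') C k) => //.
  apply: pD' => // c; rewrite inE; split=> [/eqP -> //|[oc c1]].
  by apply/eqP; have [//|E] := only' c (memD' c oc c1); move: oc; rewrite E.
(* The curl has an EO, an EU or a virtual crossing; in the last case no chord is added. *)
have [ov|nov] := pselect (over D' (s0, t0)).
  apply: (isolated (s0, t0)) => //=; first exact: over_asym.
have [ov2|nov2] := pselect (over D' (t0, s0)).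
  by apply: (isolated (t0, s0)) => //= c []; [right|left].
apply: (@same_invariants_eq R (gauss_of D) (gauss_of D') C) => //; rewrite -[C]cats0; apply: pD' => // c; split=> // -[oc c1].
by have [E|E] := memD' c oc c1; move: oc; rewrite E.
Qed.

End Move1.

(** * Reidemeister move II *)

Section Signs.
Variable R : realType.
Implicit Types h : R -> R.

Lemma derive_le0_left h x : derivable h x 1 -> h x = 0 ->
  (forall d, 0 < d -> exists t, [/\ x - d < t, t < x & 0 <= h t]) -> 'D_1 h x <= 0.
Proof.
move=> dh hx H; rewrite leNgt; apply/negP => h'0.
have e0 : 0 < 'D_1 h x / 2 by rewrite divr_gt0.
have /nbhs_ballP[d /= d0 B] := derive_near dh e0.
have [t [t1 t2 ht]] := H d d0.
have : ball x d t by rewrite /ball /= ger0_norm; lra.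
move=> /B; rewrite hx subr0 /= ler_norml => /andP[_].
rewrite [`|t - x|]ler0_norm; last by lra.
have -> : (t - x) *: 'D_1 h x = (t - x) * 'D_1 h x by [].
have : 0 < (x - t) * 'D_1 h x by rewrite mulr_gt0// subr_gt0.
clear -ht; move: ('D_1 h x) ht => y ht; lra.
Qed.

Lemma derive_ge0_right h x : derivable h x 1 -> h x = 0 ->
  (forall d, 0 < d -> exists t, [/\ x < t, t < x + d & 0 <= h t]) -> 0 <= 'D_1 h x.
Proof.
move=> dh hx H; rewrite leNgt; apply/negP => h'0.
have e0 : 0 < - 'D_1 h x / 2 by rewrite divr_gt0// oppr_gt0.
have /nbhs_ballP[d /= d0 B] := derive_near dh e0.
have [t [t1 t2 ht]] := H d d0.
have : ball x d t by rewrite /ball /= ler0_norm; lra.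
move=> /B; rewrite hx subr0 /= ler_norml => /andP[_].
rewrite [`|t - x|]ger0_norm; last by lra.
have -> : (t - x) *: 'D_1 h x = (t - x) * 'D_1 h x by [].
have : 0 < (t - x) * - 'D_1 h x by rewrite mulr_gt0// ?subr_gt0// oppr_gt0.
clear -ht; move: ('D_1 h x) ht => y ht; lra.
Qed.

(** Being positive at -1 and 1, h stays nonnegative before x1 and after x2 by the intermediate value
    theorem. The inequalities are weak; in the application, transversality makes them strict. *)
Lemma bigon_signs h x1 x2 : (forall x, derivable h x 1) ->
  0 < h (-1) -> 0 < h 1 -> -1 < x1 -> x1 < x2 -> x2 < 1 ->
  (forall x, x \in `[-1, 1] -> (h x = 0 <-> x = x1 \/ x = x2)) ->
  'D_1 h x1 <= 0 /\ 0 <= 'D_1 h x2.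
Proof.
move=> dh hl hr x1l x12 x2r hz.
have ch : continuous h by exact: derivable_continuous.
have posl t : -1 <= t -> t < x1 -> 0 <= h t.
  move=> t1 tx; rewrite leNgt; apply/negP => ht.
  have [] := @IVT R h (-1) t 0 t1 (continuous_subspaceT ch).
    by rewrite ge_min le_max (ltW ht) (ltW hl) orbT.
  move=> c; rewrite in_itv /= => /andP[c1 ct] hc.
  have cI : c \in `[-1, 1] by rewrite in_itv /= c1 /=; lra.
  by have [E|E] := (hz c cI).1 hc; lra.
have posr t : t <= 1 -> x2 < t -> 0 <= h t.
  move=> t1 tx; rewrite leNgt; apply/negP => ht.
  have [] := @IVT R h t 1 0 t1 (continuous_subspaceT ch).
    by rewrite ge_min le_max (ltW ht) (ltW hr) orbT.
  move=> c; rewrite in_itv /= => /andP[c1 ct] hc.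
  have cI : c \in `[-1, 1] by rewrite in_itv /= ct andbT; lra.
  by have [E|E] := (hz c cI).1 hc; lra.
have h1 : h x1 = 0 by apply/hz; [rewrite in_itv /=; lra|left].
have h2 : h x2 = 0 by apply/hz; [rewrite in_itv /=; lra|right].
split.
  apply: derive_le0_left => // d d0; have [le|lt] := leP (x1 + 1) d.
    by exists ((x1 - 1) / 2); split; [lra|lra|apply: posl; lra].
  by exists (x1 - d / 2); split; [lra|lra|apply: posl; lra].
apply: derive_ge0_right => // d d0; have [le|lt] := leP (1 - x2) d.
  by exists ((x2 + 1) / 2); split; [lra|lra|apply: posr; lra].
by exists (x2 + d / 2); split; [lra|lra|apply: posr; lra].
Qed.

End Signs.

Section Move2.
Variable R : realType.
Implicit Types D : diagram R.

Lemma strand_point D a b f t : graph_strand D a b f -> t \in `[a, b] ->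
  D t = (abscissa D t, f (abscissa D t)).
Proof. by case=> _ _ gf _ tI; rewrite [LHS]surjective_pairing gf. Qed.

Lemma strand_at D a b f x : graph_strand D a b f -> -1 <= x <= 1 ->
  exists t, [/\ t \in `[a, b], abscissa D t = x & D t = (x, f x)].
Proof.
move=> gs x1; have [t tI tx] := strand_onto gs x1.
by exists t; split=> //; rewrite (strand_point gs tI) tx.
Qed.

Lemma strand_agree_ends D D' a b f h : agree_off D D' a b ->
  graph_strand D a b f -> graph_strand D' a b h -> f (-1) = h (-1) /\ f 1 = h 1.
Proof.
move=> ag gs gs'; have [ab _ gf ends] := gs; have [_ _ gh _] := gs'.
have aI : a \in `[a, b] by rewrite in_itv /= lexx ltW.
have bI : b \in `[a, b] by rewrite in_itv /= lexx ltW.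
have [ea eb] := agree_off_ends ag.
have := gf a aI; have := gf b bI; rewrite ea eb gh// gh//.
by rewrite ea eb in ends; case: ends => -[-> ->] -> ->.
Qed.

Lemma strand_same_double D a b f s t : graph_strand D a b f ->
  s \in `[a, b] -> t \in `[a, b] -> D s = D t -> s = t.
Proof. by move=> gs sI tI e; apply: (strand_inj gs) => //; rewrite /abscissa e. Qed.

Lemma strand_writhe_neq0 D s t : s != t -> D s = D t -> writhe D (s, t) != 0.
Proof. by move=> st e; rewrite /writhe sgz_eq0; exact: curve_transverse. Qed.

Lemma derive_const0 (x : R) : 'D_1 (fun=> 0 : R) x = 0.
Proof. exact: derive_cst. Qed.

Lemma move2_invariants D D' : move2 D D' ->
  same_invariants (gauss_of D) (gauss_of D').
Proof.
move=> [a [b [c [d [f [h [ag DJ D'J [gm gm' gf gf'] [bnd [x1 [x2 [/andP[x1l x12] x2r hz]]] [p pass]]]]]]]]].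
pose T := `[a, b]; pose M := `[c, d].
have xI t : t \in T -> abscissa D t \in `[-1, 1].
  by move=> tI; rewrite in_itv /=; exact: strand_bounds gm tI.
have sep : apart T M.
  move=> t tT; apply/negP => tM; have := strand_point gm tT.
  rewrite (strand_point gf tM) => -[/esym/eqP].
  by have [/andP[/gt_eqF-> _] _] := bnd _ (xI t tT).
have sep' : apart M T by move=> t tM; apply/negP => /sep; rewrite tM.
have JE t : (`[a, b]%classic `|` `[c, d]%classic) t <-> t \in T \/ t \in M by [].
have abJ : `[a, b]%classic `<=` `[a, b]%classic `|` `[c, d]%classic by left.
have [C [pD pD' wC offC]] := box_chords ag abJ DJ D'J.
have offT : off T C.
  by move=> k /offC[c1 c2]; split; apply/negP => cI; [apply: c1|apply: c2]; left.
have offM : off M C.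
  by move=> k /offC[c1 c2]; split; apply/negP => cI; [apply: c1|apply: c2]; right.
have J2 (E : diagram R) (EJ : E @^-1` @box R = `[a, b]%classic `|` `[c, d]%classic) q u :
    over E (q, u) -> q \in T \/ q \in M -> u \in T \/ u \in M.
  move=> /over_double[_ e] qJ.
  have : (E @^-1` @box R) q by rewrite EJ.
  by have -> : (E @^-1` @box R) q = (E @^-1` @box R) u; [rewrite /preimage /= e|rewrite EJ].
have pD0 : perm_eq (chords D) C.
  rewrite -[C]cats0; apply: pD => // -[q u]; split=> // -[oqu /= qJ].
  have [/eqP qu e] := over_double oqu.
  have cross s t : s \in T -> t \in M -> D s = D t -> False.
    move=> sT tM; rewrite (strand_point gm sT) (strand_point gf tM) => -[_ /eqP].
    by have [/andP[/gt_eqF-> _] _] := bnd _ (xI s sT).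
  have [qT|qM] := (JE q).1 qJ; have [uT|uM] := J2 _ DJ _ _ oqu ((JE q).1 qJ).
  - by case: qu; exact: strand_same_double gm qT uT e.
  - by case: (cross q u).
  - by case: (cross u q).
  - by case: qu; exact: strand_same_double gf qM uM e.
have x1I : -1 <= x1 <= 1 by lra.
have x2I : -1 <= x2 <= 1 by lra.
have h1 : h x1 = 0 by apply/hz; [rewrite in_itv|left].
have h2 : h x2 = 0 by apply/hz; [rewrite in_itv|right].
have [t1 [t1T t1x]] := strand_at gm' x1I; rewrite h1 => D1.
have [t2 [t2T t2x]] := strand_at gm' x2I; rewrite h2 => D2.
have [u1 [u1M u1x E1]] := strand_at gf' x1I.
have [u2 [u2M u2x E2]] := strand_at gf' x2I.
have e1 : D' t1 = D' u1 by rewrite D1 E1.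
have e2 : D' t2 = D' u2 by rewrite D2 E2.
have neTM s t : s \in T -> t \in M -> s != t.
  by move=> sT tM; apply/eqP => st; have := sep s sT; rewrite st tM.
have cross s t : s \in T -> t \in M -> D' s = D' t -> (s, t) = (t1, u1) \/ (s, t) = (t2, u2).
  move=> sT tM e; move: (e); rewrite (strand_point gm' sT) (strand_point gf' tM) => -[ex hx].
  have sI : abscissa D' s \in `[-1, 1] by rewrite in_itv /=; exact: strand_bounds gm' sT.
  have [E|E] := (hz _ sI).1 hx; [left|right]; congr pair.
  - by apply: (strand_inj gm') => //; rewrite t1x.
  - by apply: (strand_inj gf') => //; rewrite u1x -ex.
  - by apply: (strand_inj gm') => //; rewrite t2x.
  - by apply: (strand_inj gf') => //; rewrite u2x -ex.
have [e [_ _ dX _ _]] := strand_abscissa gm'.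
have [e' [_ _ dY _ _]] := strand_abscissa gf'.
have absx1 : `|x1| < 1 by rewrite ltr_norml; lra.
have absx2 : `|x2| < 1 by rewrite ltr_norml; lra.
have w1 : writhe D' (t1, u1) = e * e' * sgz (- 'D_1 h x1).
  have t1o : t1 \in `]a, b[ by apply: (strand_interior gm') => //; rewrite t1x.
  have u1o : u1 \in `]c, d[ by apply: (strand_interior gf') => //; rewrite u1x.
  by rewrite (strand_det gm' gf' t1o u1o e1) dX// dY// t1x derive_const0 sub0r.
have w2 : writhe D' (t2, u2) = e * e' * sgz (- 'D_1 h x2).
  have t2o : t2 \in `]a, b[ by apply: (strand_interior gm') => //; rewrite t2x.
  have u2o : u2 \in `]c, d[ by apply: (strand_interior gf') => //; rewrite u2x.
  by rewrite (strand_det gm' gf' t2o u2o e2) dX// dY// t2x derive_const0 sub0r.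
have n1 := strand_writhe_neq0 (neTM _ _ t1T u1M) e1.
have n2 := strand_writhe_neq0 (neTM _ _ t2T u2M) e2.
(* The old arc lies above the fixed strand and the ends are kept, so h is positive on both sides of
   the box. *)
have [hl hr] := strand_agree_ends ag gm gm'.
have dh x : derivable h x 1 by case: gm' => _ sh _ _; exact: smooth_derivable.
have hl0 : 0 < h (-1).
  rewrite -hl; have [|/andP[] //] := bnd (-1); rewrite in_itv /=; lra.
have hr0 : 0 < h 1.
  rewrite -hr; have [|/andP[] //] := bnd 1; rewrite in_itv /=; lra.
have [s1 s2] := bigon_signs dh hl0 hr0 x1l x12 x2r hz.
have w21 : writhe D' (t2, u2) = - writhe D' (t1, u1).
  move: n1 n2; rewrite w1 w2 !mulf_eq0 !negb_or !sgz_eq0 => /andP[_ ne1] /andP[_ ne2].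
  have g1 : 0 < - 'D_1 h x1 by rewrite lt_neqAle eq_sym ne1 oppr_ge0.
  have g2 : - 'D_1 h x2 < 0 by rewrite lt_neqAle ne2 oppr_le0.
  by rewrite (gtr0_sgz g1) (ltr0_sgz g2) mulr1 mulrN1.
have t12 : t1 != t2 by apply/eqP => E; move: x12; rewrite -t1x -t2x E ltxx.
have inJ' q u : over D' (q, u) -> (q \in T \/ q \in M) ->
  [\/ (q, u) = (t1, u1), (q, u) = (t2, u2), (u, q) = (t1, u1) | (u, q) = (t2, u2)].
  move=> oqu qJ; have uJ := J2 _ D'J _ _ oqu qJ; have [/eqP qu e0] := over_double oqu.
  case: qJ uJ => qI [] uI.
  - by case: qu; exact: strand_same_double gm' qI uI e0.
  - by have [|] := cross q u qI uI e0; [constructor 1|constructor 2].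
  - by have [|] := cross u q uI qI (esym e0); [constructor 3|constructor 4].
  - by case: qu; exact: strand_same_double gf' qI uI e0.
have p1 := pass t1 u1 t1T u1M e1; have p2 := pass t2 u2 t2T u2M e2.
case: p {pass} p1 p2 => p1 p2.
- apply: (@bigon_chords R T M (gauss_of D) (gauss_of D') C (t1, u1) (t2, u2) sep offT offM
    t1T t2T u1M u2M w21 pD0 _ wC).
  apply: pD' => [|[q u]]; first by rewrite /= inE xpair_eqE negb_and t12.
  rewrite !inE; split=> [/orP[]/eqP[-> ->]|[oqu qJ]]; [by split=> //; left..|].
  case: (inJ' q u oqu qJ) => -[E F]; rewrite ?E ?F ?eqxx ?orbT//.
    by move: oqu; rewrite E F => /over_asym.
  by move: oqu; rewrite E F => /over_asym.
(* When the moving arc passes below, the over points are on the fixed strand, and T and M exchange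
   roles. *)
- have w12 : writhe D' (u2, t2) = - writhe D' (u1, t1) by rewrite writheN w21 [in RHS]writheN.
  apply: (@bigon_chords R M T (gauss_of D) (gauss_of D') C (u1, t1) (u2, t2) sep' offM offT
    u1M u2M t1T t2T w12 pD0 _ wC).
  apply: pD' => [|[q u]]; first by rewrite /= inE xpair_eqE negb_and t12 orbT.
  rewrite !inE; split=> [/orP[]/eqP[-> ->]|[oqu qJ]]; [by split=> //; right..|].
  case: (inJ' q u oqu qJ) => -[E F]; rewrite ?E ?F ?eqxx ?orbT//.
    by move: oqu; rewrite E F => /over_asym.
  by move: oqu; rewrite E F => /over_asym.
- apply: (@same_invariants_eq R (gauss_of D) (gauss_of D') C) => //.
  rewrite -[C]cats0; apply: pD' => // -[q u]; split=> // -[oqu qJ].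
  case: p1 p2 => [p11 p12] [p21 p22].
  by case: (inJ' q u oqu qJ) => -[E F]; move: oqu; rewrite E F.
Qed.

End Move2.

(** * Reidemeister move III *)

Section Diagonal.
Variable R : realType.
Implicit Types f : R -> R.

(** As |f'| < 1, the function f x - x is strictly decreasing; its signs at -1 and 1 force a unique
    zero, on the side of 0 given by f 0. Applied to - f, the lemma treats the other diagonal. *)
Lemma diagonal_crossing f : (forall x, derivable f x 1) ->
  (forall x, x \in `[-1, 1] -> `|f x| < 1 /\ `|'D_1 f x| < 1) ->
  exists x0, [/\ `|x0| < 1, f x0 = x0, sgz x0 = sgz (f 0)
    & forall x, x \in `[-1, 1] -> f x = x -> x = x0].
Proof.
move=> df bnd; pose g x := f x - x.
have dg x : derivable g x 1 by apply: derivableB => //; exact: derivable_id.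
have g' x : 'D_1 g x = 'D_1 f x - 1 by rewrite deriveB// ?derive_id//; exact: derivable_id.
have cg : continuous g by exact: derivable_continuous.
have decr : {in `[-1, 1] &, forall x y, x < y -> g y < g x}.
  move=> x y xI yI xy; move: xI yI; rewrite !in_itv /= => /andP[x1 _] /andP[_ y1].
  have [||z] := @MVT R g (fun x => 'D_1 g x) x y xy.
  - by move=> z _; exact/derivableP.
  - exact: continuous_subspaceT.
  rewrite in_itv /= => /andP[xz zy] e.
  have zI : z \in `[-1, 1].
    by rewrite in_itv /= (le_trans x1 (ltW xz)) (le_trans (ltW zy) y1).
  have [_] := bnd z zI; rewrite ltr_norml => /andP[_ fz].
  rewrite -subr_lt0 e g' pmulr_llt0 ?subr_gt0// subr_lt0//.
have I1 : (1 : R) \in `[-1, 1] by rewrite in_itv /=; lra.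
have Im : (-1 : R) \in `[-1, 1] by rewrite in_itv /=; lra.
have I0 : (0 : R) \in `[-1, 1] by rewrite in_itv /=; lra.
have gl : 0 < g (-1).
  by have [+ _] := bnd _ Im; rewrite /g ltr_norml opprK => /andP[+ _]; lra.
have gr : g 1 < 0 by have [+ _] := bnd _ I1; rewrite /g ltr_norml => /andP[_]; lra.
have le11 : -1 <= (1 : R) by lra.
have [|x0 x0I gx0] := @IVT R g (-1) 1 0 le11 (continuous_subspaceT cg).
  by rewrite ge_min le_max (ltW gl) (ltW gr) orbT.
have fx0 : f x0 = x0 by apply/eqP; rewrite -subr_eq0; apply/eqP.
exists x0; split=> //.
- by have [+ _] := bnd _ x0I; rewrite fx0.
- have [lt|lt|E] := ltgtP x0 0; last by rewrite -fx0 E.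
    have := decr _ _ x0I I0 lt; rewrite gx0 {1}/g subr0 => f0.
    by rewrite !ltr0_sgz.
  have := decr _ _ I0 x0I lt; rewrite gx0 {1}/g subr0 => f0.
  by rewrite !gtr0_sgz.
- move=> x xI fx; have gx : g x = 0 by rewrite /g fx subrr.
  have [lt|lt|//] := ltgtP x x0.
    by have := decr _ _ xI x0I lt; rewrite gx gx0 ltxx.
  by have := decr _ _ x0I xI lt; rewrite gx gx0 ltxx.
Qed.

End Diagonal.

Section Config.
Variables (R : realType) (E : diagram R).
Variables (I0 I1 I2 : interval R).

(* I0 is the moving arc, I1 runs along y = x and I2 along y = - x; s1, t1 are the
   parameters of the crossing of I0 and I1, s2, u1 of I0 and I2, t2, u2 of I1 and
   I2.  The sign sigma is -1 before the move and 1 after it; h0, h1 and - h2 are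
   the horizontal directions of the three strands. *)
Record three_strands (sigma h0 h1 h2 : int) (s1 s2 t1 t2 u1 u2 : R) : Prop := {
  ts_s1 : s1 \in I0; ts_s2 : s2 \in I0;
  ts_t1 : t1 \in I1; ts_t2 : t2 \in I1;
  ts_u1 : u1 \in I2; ts_u2 : u2 \in I2;
  ts_st : E s1 = E t1; ts_su : E s2 = E u1; ts_tu : E t2 = E u2;
  ts_ss : {in I0 &, forall s t, E s = E t -> s = t};
  ts_tt : {in I1 &, forall s t, E s = E t -> s = t};
  ts_uu : {in I2 &, forall s t, E s = E t -> s = t};
  ts_st_only : forall s t, s \in I0 -> t \in I1 -> E s = E t -> s = s1 /\ t = t1;
  ts_su_only : forall s u, s \in I0 -> u \in I2 -> E s = E u -> s = s2 /\ u = u1;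
  ts_tu_only : forall t u, t \in I1 -> u \in I2 -> E t = E u -> t = t2 /\ u = u2;
  ts_s : sgz (s1 - s2) = sigma * h0;
  ts_t : sgz (t1 - t2) = sigma * h1;
  ts_u : sgz (u1 - u2) = sigma * h2;
  ts_wst : writhe E (s1, t1) = h0 * h1;
  ts_wsu : writhe E (s2, u1) = h0 * h2;
  ts_wtu : writhe E (t2, u2) = h1 * h2;
  ts_01 : apart I0 I1; ts_02 : apart I0 I2; ts_12 : apart I1 I2 }.

(** [Virtually] takes the value of [Below] as a default; it is excluded by the hypotheses at each
    use. *)
Definition orient (p : passage) (s t : R) : R * R := if p is Above then (s, t) else (t, s).

Lemma three_strands_chords sigma h0 h1 h2 s1 s2 t1 t2 u1 u2 p1 p2 p3 :
  three_strands sigma h0 h1 h2 s1 s2 t1 t2 u1 u2 ->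
  (forall q u, over E (q, u) -> [\/ q \in I0, q \in I1 | q \in I2] ->
     [\/ u \in I0, u \in I1 | u \in I2]) ->
  p1 <> Virtually -> p2 <> Virtually -> p3 <> Virtually ->
  passes E p1 [set` I0] [set` I1] -> passes E p2 [set` I0] [set` I2] ->
  passes E p3 [set` I1] [set` I2] ->
  let L := [:: orient p1 s1 t1; orient p2 s2 u1; orient p3 t2 u2] in
  uniq L /\ forall c, c \in L <-> over E c /\ [\/ c.1 \in I0, c.1 \in I1 | c.1 \in I2].
Proof.
move=> ts closed np1 np2 np3 P1 P2 P3 L.
have n0 (I I' : interval R) x : apart I I' -> x \in I' -> x \notin I.
  by move=> II' xI'; apply/negP => /II'; rewrite xI'.
split.
  (* With the strands numbered 0, 1, 2, the three crossings have label sums 1, 2, 3, distinct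
     whichever strands are on top. *)
  pose lab (x : R) := if x \in I0 then 0%N else if x \in I1 then 1%N else 2%N.
  have l0 x : x \in I0 -> lab x = 0%N by rewrite /lab => ->.
  have l1 x : x \in I1 -> lab x = 1%N.
    by move=> xI; rewrite /lab xI (negbTE (n0 _ _ _ (ts_01 ts) xI)).
  have l2 x : x \in I2 -> lab x = 2%N.
    move=> xI; rewrite /lab (negbTE (n0 _ _ _ (ts_02 ts) xI)).
    by rewrite (negbTE (n0 _ _ _ (ts_12 ts) xI)).
  apply: (@map_uniq _ _ (fun c : R * R => lab c.1 + lab c.2)%N).
  have -> : [seq (lab c.1 + lab c.2)%N | c <- L] = [:: 1; 2; 3]%N.
    rewrite /L /=; case: p1 {P1 np1 L} => //=; case: p2 {P2 np2} => //=; case: p3 {P3 np3} => //=;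
    by rewrite (l0 _ (ts_s1 ts)) (l0 _ (ts_s2 ts)) (l1 _ (ts_t1 ts)) (l1 _ (ts_t2 ts))
      (l2 _ (ts_u1 ts)) (l2 _ (ts_u2 ts)).
  by [].
have o1 : over E (orient p1 s1 t1).
  by have := P1 s1 t1 (ts_s1 ts) (ts_t1 ts) (ts_st ts); case: p1 np1 {P1 L}.
have o2 : over E (orient p2 s2 u1).
  by have := P2 s2 u1 (ts_s2 ts) (ts_u1 ts) (ts_su ts); case: p2 np2 {P2 L}.
have o3 : over E (orient p3 t2 u2).
  by have := P3 t2 u2 (ts_t2 ts) (ts_u2 ts) (ts_tu ts); case: p3 np3 {P3 L}.
have orientP p x y : over E (orient p x y) -> over E (x, y) -> orient p x y = (x, y).
  by case: p => //= o /over_asym.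
have orientP' p x y : over E (orient p x y) -> over E (y, x) -> orient p x y = (y, x).
  by case: p => //= o /over_asym.
have Jor (J : R -> Prop) p x y : J x -> J y -> J (orient p x y).1 by case: p.
move=> c; rewrite !inE; split.
  case/or3P => /eqP ->; split=> //.
  - by apply: (Jor (fun x => [\/ x \in I0, x \in I1 | x \in I2]));
      [constructor 1; exact: ts_s1 ts|constructor 2; exact: ts_t1 ts].
  - by apply: (Jor (fun x => [\/ x \in I0, x \in I1 | x \in I2]));
      [constructor 1; exact: ts_s2 ts|constructor 3; exact: ts_u1 ts].
  - by apply: (Jor (fun x => [\/ x \in I0, x \in I1 | x \in I2]));
      [constructor 2; exact: ts_t2 ts|constructor 3; exact: ts_u2 ts].
case: c => q u [oqu /= qJ]; have uJ := closed _ _ oqu qJ.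
have [/eqP qu e] := over_double oqu.
have fin p x y : over E (orient p x y) -> (q, u) = (x, y) \/ (q, u) = (y, x) ->
    (q, u) = orient p x y.
  by move=> oo [E'|E']; rewrite E' in oqu *; [rewrite orientP|rewrite orientP'].
case: qJ uJ => qI [] uI.
- by case: qu; exact: (ts_ss ts qI uI e).
- by rewrite (fin _ _ _ o1) ?eqxx//; have [-> ->] := ts_st_only ts qI uI e; left.
- by rewrite (fin _ _ _ o2) ?eqxx ?orbT//; have [-> ->] := ts_su_only ts qI uI e; left.
- by rewrite (fin _ _ _ o1) ?eqxx//; have [-> ->] := ts_st_only ts uI qI (esym e); right.
- by case: qu; exact: (ts_tt ts qI uI e).
- by rewrite (fin _ _ _ o3) ?eqxx ?orbT//; have [-> ->] := ts_tu_only ts qI uI e; left.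
- by rewrite (fin _ _ _ o2) ?eqxx ?orbT//; have [-> ->] := ts_su_only ts uI qI (esym e); right.
- by rewrite (fin _ _ _ o3) ?eqxx ?orbT//; have [-> ->] := ts_tu_only ts uI qI (esym e); right.
- by case: qu; exact: (ts_uu ts qI uI e).
Qed.

End Config.

Section Existence.
Variables (R : realType) (E : diagram R).

(** If the intervals met, the start of one would lie in the other; there the abscissa is 1 or -1 and
    both graphs would have the same ordinate. *)
Lemma strands_apart a b c d f h : graph_strand E a b f -> graph_strand E c d h ->
  f 1 != h 1 -> f (-1) != h (-1) -> apart `[a, b] `[c, d].
Proof.
move=> gf gh n1 nm; have [ab _ _ ea] := gf; have [cd _ _ ec] := gh.
move=> t; rewrite !in_itv /= => /andP[a1 tb]; apply/negP => /andP[ct td].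
have H x : x \in `[a, b] -> x \in `[c, d] -> (E x).1 = 1 \/ (E x).1 = -1 -> False.
  move=> xI xJ; have e : f (E x).1 = h (E x).1.
    by have := strand_point gf xI; rewrite (strand_point gh xJ) => -[->].
  by case=> E1; move: e n1 nm; rewrite E1 => ->; rewrite eqxx.
have [ac|ca] := leP a c.
  apply: (H c); rewrite ?in_itv /= ?lexx ?(ltW cd) ?ac ?(le_trans ct tb)//.
  by case: ec => -[-> _]; [right|left].
apply: (H a); rewrite ?in_itv /= ?lexx ?(ltW ab) ?(ltW ca) ?(le_trans a1 td)//.
by case: ea => -[-> _]; [right|left].
Qed.

(** Negating the direction of the strand along y = - x absorbs the negative slope differences at its
    two crossings and the sign of its meeting point with the moving arc. The three orders then
    become sigma h_i and the three writhes h_i h_j. *)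
Lemma three_strands_exist a b c d e g f :
  graph_strand E a b f -> graph_strand E c d id -> graph_strand E e g -%R ->
  (forall x, x \in `[-1, 1] -> `|f x| < 1 /\ `|'D_1 f x| < 1) ->
  exists h0 h1 h2 : int, [/\ h0 = 1 \/ h0 = -1, h1 = 1 \/ h1 = -1, h2 = 1 \/ h2 = -1,
    [/\ (E a).1 = - h0%:~R, (E c).1 = - h1%:~R & (E e).1 = h2%:~R]
  & exists s1 s2 t1 t2 u1 u2,
    three_strands E `[a, b] `[c, d] `[e, g] (sgz (f 0)) h0 h1 h2 s1 s2 t1 t2 u1 u2].
Proof.
move=> g0 g1 g2 bnd.
have df x : derivable f x 1 by case: g0 => _ sf _ _; exact: smooth_derivable.
have dNf x : derivable (- f) x 1 by exact: derivableN.
have [xA [xA1 fxA sgA onlyA]] := diagonal_crossing df bnd.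
have [|xB [xB1 fxB sgB onlyB]] := diagonal_crossing dNf.
  by move=> x xI; rewrite deriveN// !normrN; exact: bnd.
have {}fxB : f xB = - xB.
  by apply: oppr_inj; rewrite opprK; exact: fxB.
have {}sgB : sgz xB = - sgz (f 0) by rewrite sgB sgzN.
have {}onlyB x : x \in `[-1, 1] -> f x = - x -> x = xB.
  by move=> xI fx; apply: onlyB => //; apply: oppr_inj; rewrite -fx; exact: opprK.
have [m0 [um0 mono0 der0 Ea _]] := strand_abscissa g0.
have [m1 [um1 mono1 der1 Ec _]] := strand_abscissa g1.
have [m2 [um2 mono2 der2 Ee _]] := strand_abscissa g2.
exists m0, m1, (- m2); split=> //.
- by case: um2 => ->; rewrite ?opprK; [right|left].
- by split=> //; rewrite Ee rmorphN.
have z1 : -1 <= (0 : R) <= 1 by lra.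
have z11 : `|0 : R| < 1 by rewrite normr0.
have le1 x : `|x : R| < 1 -> -1 <= x <= 1 by rewrite ltr_norml => /andP[/ltW -> /ltW ->].
have [s1 [s1I s1x Es1]] := strand_at g0 (le1 _ xA1).
have [s2 [s2I s2x Es2]] := strand_at g0 (le1 _ xB1).
have [t1 [t1I t1x Et1]] := strand_at g1 (le1 _ xA1).
have [t2 [t2I t2x Et2]] := strand_at g1 z1.
have [u1 [u1I u1x Eu1]] := strand_at g2 (le1 _ xB1).
have [u2 [u2I u2x Eu2]] := strand_at g2 z1.
have st : E s1 = E t1 by rewrite Es1 Et1 fxA.
have su : E s2 = E u1 by rewrite Es2 Eu1 fxB.
have tu : E t2 = E u2 by rewrite Et2 Eu2 oppr0.
have absI s : s \in `[a, b] -> abscissa E s \in `[-1, 1].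
  by move=> sI; rewrite in_itv /=; exact: strand_bounds g0 sI.
have Dopp (x : R) : 'D_1 (-%R : R -> R) x = -1.
  have -> : (-%R : R -> R) = (fun y : R => - id y) by [].
  by rewrite (@deriveN _ _ _ id) ?derive_id//; exact: derivable_id.
have Did (x : R) : 'D_1 (id : R -> R) x = 1 by rewrite derive_id.
have int0 s : s \in `[a, b] -> `|abscissa E s| < 1 -> s \in `]a, b[.
  exact: (strand_interior g0).
have int1 s : s \in `[c, d] -> `|abscissa E s| < 1 -> s \in `]c, d[.
  exact: (strand_interior g1).
have int2 s : s \in `[e, g] -> `|abscissa E s| < 1 -> s \in `]e, g[.
  exact: (strand_interior g2).
have s1o : s1 \in `]a, b[ by apply: int0; rewrite ?s1x.
have s2o : s2 \in `]a, b[ by apply: int0; rewrite ?s2x.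
have t1o : t1 \in `]c, d[ by apply: int1; rewrite ?t1x.
have t2o : t2 \in `]c, d[ by apply: int1; rewrite ?t2x.
have u1o : u1 \in `]e, g[ by apply: int2; rewrite ?u1x.
have u2o : u2 \in `]e, g[ by apply: int2; rewrite ?u2x.
have xAI : xA \in `[-1, 1] by rewrite in_itv /=; exact: le1.
have xBI : xB \in `[-1, 1] by rewrite in_itv /=; exact: le1.
have I1 : (1 : R) \in `[-1, 1] by rewrite in_itv /=; lra.
have Im : (-1 : R) \in `[-1, 1] by rewrite in_itv /=; lra.
have [/ltr_normlP[f1a f1b] _] := bnd _ I1; have [/ltr_normlP[fma fmb] _] := bnd _ Im.
exists s1, s2, t1, t2, u1, u2; split=> //.
- by move=> x y xI yI; exact: strand_same_double g0 xI yI.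
- by move=> x y xI yI; exact: strand_same_double g1 xI yI.
- by move=> x y xI yI; exact: strand_same_double g2 xI yI.
- move=> s t sI tI; rewrite (strand_point g0 sI) (strand_point g1 tI) => -[ex ey].
  have sx : abscissa E s = xA by apply: onlyA; rewrite ?absI// ey -ex.
  split; first by apply: (strand_inj g0) => //; rewrite s1x.
  by apply: (strand_inj g1) => //; rewrite t1x -ex.
- move=> s t sI tI; rewrite (strand_point g0 sI) (strand_point g2 tI) => -[ex ey].
  have sx : abscissa E s = xB by apply: onlyB; rewrite ?absI// ey -ex.
  split; first by apply: (strand_inj g0) => //; rewrite s2x.
  by apply: (strand_inj g2) => //; rewrite u1x -ex.
- move=> s t sI tI; rewrite (strand_point g1 sI) (strand_point g2 tI) => -[ex ey].
  have sx : abscissa E s = 0 by move: ey; rewrite -ex /=; lra.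
  split; first by apply: (strand_inj g1) => //; rewrite t2x.
  by apply: (strand_inj g2) => //; rewrite u2x -ex.
- rewrite mono0// s1x s2x; have [lt|lt|E0] := ltgtP (f 0) 0.
  + rewrite (ltr0_sgz lt) in sgA sgB *.
    have : xA < 0 by rewrite -sgz_lt0 sgA.
    have : 0 < xB by rewrite -sgz_gt0 sgB.
    by move=> ? ?; rewrite ltr0_sgz ?mulN1r ?mulrN1//; lra.
  + rewrite (gtr0_sgz lt) in sgA sgB *.
    have : 0 < xA by rewrite -sgz_gt0 sgA.
    have : xB < 0 by rewrite -sgz_lt0 sgB.
    by move=> ? ?; rewrite gtr0_sgz ?mul1r ?mulr1//; lra.
  + move: sgA sgB; rewrite E0 sgz0 oppr0 => /eqP + /eqP.
    by rewrite !sgz_eq0 => /eqP -> /eqP ->; rewrite subrr sgz0 mulr0 mul0r.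
- by rewrite mono1// t1x t2x subr0 sgA mulrC.
- by rewrite mono2// u1x u2x subr0 sgB !mulrN mulrC.
- rewrite (strand_det g0 g1 s1o t1o st) der0// der1// s1x Did gtr0_sgz ?mulr1//.
  by have [_ /ltr_normlP[_]] := bnd _ xAI; rewrite subr_gt0.
- rewrite (strand_det g0 g2 s2o u1o su) der0// der2// s2x Dopp ltr0_sgz ?mulrN1 ?mulrN//.
  by have [_ /ltr_normlP[? _]] := bnd _ xBI; rewrite subr_lt0 ltrNl.
- rewrite (strand_det g1 g2 t2o u2o tu) der1// der2// t2x Dopp Did ltr0_sgz ?mulrN1 ?mulrN//.
- apply: strands_apart g0 g1 _ _ => /=; first by rewrite lt_eqF.
  by rewrite gt_eqF// ltrNl.
- apply: strands_apart g0 g2 _ _ => /=; first by rewrite gt_eqF// ltrNl.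
  by rewrite opprK lt_eqF.
- apply: strands_apart g1 g2 _ _ => /=; first by rewrite gt_eqF.
  by rewrite opprK lt_eqF.
Qed.

End Existence.


(* p1, p2, p3 are the passages of strand 0 over strand 1, of 0 over 2 and of 1 over
   2; the two cyclic patterns are excluded. *)
Definition layered (p1 p2 p3 : passage) : Prop :=
  match p1, p2, p3 with
  | Above, Above, Above | Above, Above, Below
  | Below, Below, Above | Below, Below, Below
  | Above, Below, Below | Below, Above, Above => True
  | _, _, _ => False
  end.

Section Move3.
Variable R : realType.
Implicit Types D : diagram R.

(* Unlike [move3], this form of the move is preserved by the crossing changes that
   turn D into EO(D): the moving arc may be the middle one. *)
Definition layered_move3 D D' : Prop :=
  exists a b c d e g f h, [/\ agree_off D D' a b,
    D @^-1` @box R = `[a, b]%classic `|` `[c, d]%classic `|` `[e, g]%classic,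
    D' @^-1` @box R = `[a, b]%classic `|` `[c, d]%classic `|` `[e, g]%classic,
    [/\ graph_strand D a b f, graph_strand D' a b h,
        graph_strand D c d id /\ graph_strand D' c d id
      & graph_strand D e g -%R /\ graph_strand D' e g -%R]
  & [/\ forall x, x \in `[-1, 1] ->
          [/\ `|f x| < 1, `|h x| < 1, `|'D_1 f x| < 1 & `|'D_1 h x| < 1],
        f 0 < 0 < h 0
      & exists p1 p2, [/\
          passes D p1 `[a, b]%classic `[c, d]%classic /\
          passes D p2 `[a, b]%classic `[e, g]%classic,
          passes D' p1 `[a, b]%classic `[c, d]%classic /\
          passes D' p2 `[a, b]%classic `[e, g]%classic
        & p1 = Virtually /\ p2 = Virtually \/
          exists p3, passes D p3 `[c, d]%classic `[e, g]%classic /\ layered p1 p2 p3]]].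

Lemma perm3 (T : eqType) (x y z : T) : [/\ perm_eq [:: x; y; z] [:: y; x; z],
  perm_eq [:: x; y; z] [:: y; z; x], perm_eq [:: x; y; z] [:: z; y; x],
  perm_eq [:: x; y; z] [:: z; x; y] & perm_eq [:: x; y; z] [:: x; z; y]].
Proof. by split; apply/permP => q /=; lia. Qed.

(** Here the directions a, b, c of [triangle_chords] are read off the diagram after the move, so
    that only d is left to supply. *)
Lemma triangle_diagrams D D' (T M B : interval R) C
    (t1 t2 m1 m2 b1 b2 t1' t2' m1' m2' b1' b2' : R) (d : int) :
  apart T M -> apart T B -> apart M B -> off T C -> off M C -> off B C ->
  {in C, writhe D =1 writhe D'} ->
  perm_eq (chords D) (C ++ triangle t1 t2 m1 m2 b1 b2) ->
  perm_eq (chords D') (C ++ triangle t1' t2' m1' m2' b1' b2') ->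
  t1 \in T -> t2 \in T -> m1 \in M -> m2 \in M -> b1 \in B -> b2 \in B ->
  t1' \in T -> t2' \in T -> m1' \in M -> m2' \in M -> b1' \in B -> b2' \in B ->
  d ^+ 2 = 1 -> sgz (t1' - t2') ^+ 2 = 1 -> sgz (m1' - m2') ^+ 2 = 1 ->
  sgz (b1' - b2') ^+ 2 = 1 ->
  sgz (t1 - t2) = - sgz (t1' - t2') -> sgz (m1 - m2) = - sgz (m1' - m2') ->
  sgz (b1 - b2) = - sgz (b1' - b2') ->
  writhe D (t1, m1) = d * sgz (t1' - t2') * sgz (m1' - m2') ->
  writhe D (t2, b1) = d * sgz (t1' - t2') * sgz (b1' - b2') ->
  writhe D (m2, b2) = d * sgz (m1' - m2') * sgz (b1' - b2') ->
  writhe D' (t1', m1') = d * sgz (t1' - t2') * sgz (m1' - m2') ->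
  writhe D' (t2', b1') = d * sgz (t1' - t2') * sgz (b1' - b2') ->
  writhe D' (m2', b2') = d * sgz (m1' - m2') * sgz (b1' - b2') ->
  same_invariants (gauss_of D) (gauss_of D').
Proof.
move=> TM TB MB oT oM oB wC P P' t1T t2T m1M m2M b1B b2B t1T' t2T' m1M' m2M' b1B' b2B'.
move=> dd aa bb cc o1 o2 o3 w1 w2 w3 w1' w2' w3'.
exact: (@triangle_chords R T M B TM TB MB t1 m1 b1 t1T m1M b1B (gauss_of D) (gauss_of D') C
  _ _ _ _ _ _ _ _ _ _ _ _ d _ _ _ oT oM oB wC P P' t1T t2T m1M m2M b1B b2B
  t1T' t2T' m1M' m2M' b1B' b2B' dd aa bb cc o1 o2 o3 erefl erefl erefl w1 w2 w3 w1' w2' w3').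
Qed.

Lemma layered_triangle D D' (I0 I1 I2 : interval R) C h0 h1 h2
    s1 s2 t1 t2 u1 u2 s1' s2' t1' t2' u1' u2' p1 p2 p3 :
  three_strands D I0 I1 I2 (-1) h0 h1 h2 s1 s2 t1 t2 u1 u2 ->
  three_strands D' I0 I1 I2 1 h0 h1 h2 s1' s2' t1' t2' u1' u2' ->
  h0 ^+ 2 = 1 -> h1 ^+ 2 = 1 -> h2 ^+ 2 = 1 ->
  off I0 C -> off I1 C -> off I2 C -> {in C, writhe D =1 writhe D'} ->
  perm_eq (chords D) (C ++ [:: orient p1 s1 t1; orient p2 s2 u1; orient p3 t2 u2]) ->
  perm_eq (chords D') (C ++ [:: orient p1 s1' t1'; orient p2 s2' u1'; orient p3 t2' u2']) ->
  layered p1 p2 p3 -> same_invariants (gauss_of D) (gauss_of D').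
Proof.
move=> T T' q0 q1 q2 off0 off1 off2 wC pD pD'.
have a01 := ts_01 T; have a02 := ts_02 T; have a12 := ts_12 T.
have sym (I J : interval R) : apart I J -> apart J I.
  by move=> IJ x xJ; apply/negP => /IJ; rewrite xJ.
have a10 := sym _ _ a01; have a20 := sym _ _ a02; have a21 := sym _ _ a12.
have m1 := ts_s1 T; have m2 := ts_s2 T; have m3 := ts_t1 T.
have m4 := ts_t2 T; have m5 := ts_u1 T; have m6 := ts_u2 T.
have m1' := ts_s1 T'; have m2' := ts_s2 T'; have m3' := ts_t1 T'.
have m4' := ts_t2 T'; have m5' := ts_u1 T'; have m6' := ts_u2 T'.
have nn (u : int) : (- u) ^+ 2 = u ^+ 2 by rewrite sqrrN.
have [os ot ou] : [/\ sgz (s1 - s2) = - h0, sgz (t1 - t2) = - h1 & sgz (u1 - u2) = - h2].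
  by rewrite (ts_s T) (ts_t T) (ts_u T) !mulN1r.
have [os' ot' ou'] : [/\ sgz (s1' - s2') = h0, sgz (t1' - t2') = h1 & sgz (u1' - u2') = h2].
  by rewrite (ts_s T') (ts_t T') (ts_u T') !mul1r.
have [rs rt ru] : [/\ sgz (s2 - s1) = h0, sgz (t2 - t1) = h1 & sgz (u2 - u1) = h2].
  by rewrite (sgzBC s1) (sgzBC t1) (sgzBC u1) os ot ou !opprK.
have [rs' rt' ru'] : [/\ sgz (s2' - s1') = - h0, sgz (t2' - t1') = - h1 & sgz (u2' - u1') = - h2].
  by rewrite (sgzBC s1') (sgzBC t1') (sgzBC u1') os' ot' ou'.
have w1 := ts_wst T; have w2 := ts_wsu T; have w3 := ts_wtu T.
have w1' := ts_wst T'; have w2' := ts_wsu T'; have w3' := ts_wtu T'.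
have v1 : writhe D (t1, s1) = - (h0 * h1) by rewrite writheN w1.
have v2 : writhe D (u1, s2) = - (h0 * h2) by rewrite writheN w2.
have v3 : writhe D (u2, t2) = - (h1 * h2) by rewrite writheN w3.
have v1' : writhe D' (t1', s1') = - (h0 * h1) by rewrite writheN w1'.
have v2' : writhe D' (u1', s2') = - (h0 * h2) by rewrite writheN w2'.
have v3' : writhe D' (u2', t2') = - (h1 * h2) by rewrite writheN w3'.
pose k1 := orient p1 s1 t1; pose k2 := orient p2 s2 u1; pose k3 := orient p3 t2 u2.
pose l1 := orient p1 s1' t1'; pose l2 := orient p2 s2' u1'; pose l3 := orient p3 t2' u2'.
have ext L L' : perm_eq [:: k1; k2; k3] L -> perm_eq [:: l1; l2; l3] L' ->
    perm_eq (chords D) (C ++ L) /\ perm_eq (chords D') (C ++ L').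
  by move=> kL lL; split; [apply: (perm_trans pD)|apply: (perm_trans pD')];
    rewrite perm_cat2l.
have [x1 x2 x3 x4 x5] := perm3 k1 k2 k3; have [y1 y2 y3 y4 y5] := perm3 l1 l2 l3.
have one : (1 : int) ^+ 2 = 1 by rewrite expr1n.
have mone : (-1 : int) ^+ 2 = 1 by rewrite sqrrN expr1n.
rewrite {}/k1 {}/k2 {}/k3 {}/l1 {}/l2 {}/l3 in ext x1 x2 x3 x4 x5 y1 y2 y3 y4 y5.
move=> lay; move: lay pD pD' ext x1 x2 x3 x4 x5 y1 y2 y3 y4 y5.
(* The cyclic and virtual patterns are absurd. In the other six the strands are named T, M, B from
   top to bottom, and d is the signature of this permutation of I0, I1, I2: swapping over and under
   negates a writhe, and swapping the two crossings on a strand negates its direction. *)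
case: p1; case: p2; case: p3; cbn [layered orient];
  first [refine (False_ind _) | move=> _ pD pD' ext x1 x2 x3 x4 x5 y1 y2 y3 y4 y5].
- have [P P'] := ext _ _ (perm_refl _) (perm_refl _).
  apply: (triangle_diagrams (d := 1) a01 a02 a12 off0 off1 off2 wC P P'
    m1 m2 m3 m4 m5 m6 m1' m2' m3' m4' m5' m6'); rewrite ?os ?ot ?ou ?rs ?rt ?ru ?os' ?ot' ?ou' ?rs' ?rt' ?ru'
    ?nn ?opprK ?w1 ?w2 ?w3 ?v1 ?v2 ?v3 ?w1' ?w2' ?w3' ?v1' ?v2' ?v3' //; ring.
- have [P P'] := ext _ _ x1 y1.
  apply: (triangle_diagrams (d := -1) a02 a01 a21 off0 off2 off1 wC P P'
    m2 m1 m5 m6 m3 m4 m2' m1' m5' m6' m3' m4'); rewrite ?os ?ot ?ou ?rs ?rt ?ru ?os' ?ot' ?ou' ?rs' ?rt' ?ru'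
    ?nn ?opprK ?w1 ?w2 ?w3 ?v1 ?v2 ?v3 ?w1' ?w2' ?w3' ?v1' ?v2' ?v3' //; ring.
- have [P P'] := ext _ _ x2 y2.
  apply: (triangle_diagrams (d := 1) a20 a21 a01 off2 off0 off1 wC P P'
    m5 m6 m2 m1 m4 m3 m5' m6' m2' m1' m4' m3'); rewrite ?os ?ot ?ou ?rs ?rt ?ru ?os' ?ot' ?ou' ?rs' ?rt' ?ru'
    ?nn ?opprK ?w1 ?w2 ?w3 ?v1 ?v2 ?v3 ?w1' ?w2' ?w3' ?v1' ?v2' ?v3' //; ring.
- have [P P'] := ext _ _ x5 y5.
  apply: (triangle_diagrams (d := -1) a10 a12 a02 off1 off0 off2 wC P P'
    m3 m4 m1 m2 m6 m5 m3' m4' m1' m2' m6' m5'); rewrite ?os ?ot ?ou ?rs ?rt ?ru ?os' ?ot' ?ou' ?rs' ?rt' ?ru'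
    ?nn ?opprK ?w1 ?w2 ?w3 ?v1 ?v2 ?v3 ?w1' ?w2' ?w3' ?v1' ?v2' ?v3' //; ring.
- have [P P'] := ext _ _ x4 y4.
  apply: (triangle_diagrams (d := 1) a12 a10 a20 off1 off2 off0 wC P P'
    m4 m3 m6 m5 m1 m2 m4' m3' m6' m5' m1' m2'); rewrite ?os ?ot ?ou ?rs ?rt ?ru ?os' ?ot' ?ou' ?rs' ?rt' ?ru'
    ?nn ?opprK ?w1 ?w2 ?w3 ?v1 ?v2 ?v3 ?w1' ?w2' ?w3' ?v1' ?v2' ?v3' //; ring.
- have [P P'] := ext _ _ x3 y3.
  apply: (triangle_diagrams (d := -1) a21 a20 a10 off2 off1 off0 wC P P'
    m6 m5 m4 m3 m2 m1 m6' m5' m4' m3' m2' m1'); rewrite ?os ?ot ?ou ?rs ?rt ?ru ?os' ?ot' ?ou' ?rs' ?rt' ?ru'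
    ?nn ?opprK ?w1 ?w2 ?w3 ?v1 ?v2 ?v3 ?w1' ?w2' ?w3' ?v1' ?v2' ?v3' //; ring.
Qed.


Lemma layered_not_virtual p1 p2 p3 : layered p1 p2 p3 ->
  [/\ p1 <> Virtually, p2 <> Virtually & p3 <> Virtually].
Proof. by case: p1; case: p2; case: p3. Qed.

Lemma unit_sqr (u : int) : u = 1 \/ u = -1 -> u ^+ 2 = 1.
Proof. by case=> ->; rewrite ?sqrrN expr1n. Qed.

Lemma layered_move3_invariants D D' : layered_move3 D D' ->
  same_invariants (gauss_of D) (gauss_of D').
Proof.
move=> [a [b [c [d [e [g [f [h [ag DJ D'J [gm gm' [g1 g1'] [g2 g2']] [bnd /andP[f0 h0]
  [p1 [p2 [[P1 P2] [P1' P2'] pp]]]]]]]]]]]]].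
have bf x : x \in `[-1, 1] -> `|f x| < 1 /\ `|'D_1 f x| < 1 by move=> /bnd[].
have bh x : x \in `[-1, 1] -> `|h x| < 1 /\ `|'D_1 h x| < 1 by move=> /bnd[].
have [k0 [k1 [k2 [K0 K1 K2 [Ea Ec Ee] [s1 [s2 [t1 [t2 [u1 [u2 T]]]]]]]]]] :=
  three_strands_exist gm g1 g2 bf.
have [l0 [l1 [l2 [L0 L1 L2 [Ea' Ec' Ee'] [s1' [s2' [t1' [t2' [u1' [u2' T']]]]]]]]]] :=
  three_strands_exist gm' g1' g2' bh.
have [a01 a02] := (ts_01 T, ts_02 T).
have nI (I : interval R) t : apart `[a, b] I -> t \in I -> t \notin `[a, b].
  by move=> aI tI; apply/negP => /aI; rewrite tI.
have [_ eD eo] := ag; have [eqa _] := agree_off_ends ag.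
have cI : c \in `[c, d] by rewrite in_itv /= lexx ltW//; case: g1.
have eI : e \in `[e, g] by rewrite in_itv /= lexx ltW//; case: g2.
(* The strands of D and D' were obtained separately; their starting points show that the directions
   coincide. *)
have E0 : l0 = k0.
  by move: Ea'; rewrite -eqa Ea => /oppr_inj /intr_inj ->.
have E1 : l1 = k1.
  by move: Ec'; rewrite -(eD c (nI _ _ a01 cI)) Ec => /oppr_inj /intr_inj ->.
have E2 : l2 = k2 by move: Ee'; rewrite -(eD e (nI _ _ a02 eI)) Ee => /intr_inj ->.
subst l0 l1 l2.
rewrite (ltr0_sgz f0) in T; rewrite (gtr0_sgz h0) in T'.
have closed (E : diagram R) (EJ : E @^-1` @box R =
    `[a, b]%classic `|` `[c, d]%classic `|` `[e, g]%classic) q u : over E (q, u) ->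
    [\/ q \in `[a, b], q \in `[c, d] | q \in `[e, g]] ->
    [\/ u \in `[a, b], u \in `[c, d] | u \in `[e, g]].
  move=> /over_double[_ E'] qJ.
  have : (E @^-1` @box R) q.
    by rewrite EJ; case: qJ => ?; [left; left|left; right|right].
  have -> : (E @^-1` @box R) q = (E @^-1` @box R) u by rewrite /preimage /= E'.
  by rewrite EJ => -[[]|] uI; [constructor 1|constructor 2|constructor 3].
case: pp => [[v1 v2]|[p3 [P3 lay]]].
  (* A virtual moving arc carries no chord, and the crossing of the other two strands, classical or
     virtual, lies off [a, b]: both diagrams have the same chords. *)
  subst p1 p2.
  have noab (E : diagram R) q u (EJ : E @^-1` @box R =
      `[a, b]%classic `|` `[c, d]%classic `|` `[e, g]%classic) :
      {in `[a, b] &, forall s t, E s = E t -> s = t} ->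
      passes E Virtually `[a, b]%classic `[c, d]%classic ->
      passes E Virtually `[a, b]%classic `[e, g]%classic ->
      over E (q, u) -> q \notin `[a, b] /\ u \notin `[a, b].
    move=> inj V1 V2 oqu; have [/eqP qu E'] := over_double oqu.
    split; apply/negP => qI.
      have [uI|uI|uI] := closed _ EJ _ _ oqu (Or31 _ _ qI).
      - by apply: qu; exact: inj qI uI E'.
      - by have [] := V1 _ _ qI uI E'.
      - by have [] := V2 _ _ qI uI E'.
    have qJ : [\/ q \in `[a, b], q \in `[c, d] | q \in `[e, g]].
      have : (E @^-1` @box R) u by rewrite EJ; left; left.
      have <- : (E @^-1` @box R) q = (E @^-1` @box R) u by rewrite /preimage /= E'.
      by rewrite EJ => -[[]|] uI; [constructor 1|constructor 2|constructor 3].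
    case: qJ => uI.
    - by apply: qu; exact: inj uI qI E'.
    - by have [] := V1 _ _ qI uI (esym E').
    - by have [] := V2 _ _ qI uI (esym E').
  have DD' : perm_eq (chords D') (chords D).
    apply: chords_perm; first exact: chords_uniq.
    case=> q u; split=> [/mem_chords|] oqu.
      by have [qI uI] := noab _ _ _ DJ (ts_ss T) P1 P2 oqu; apply/eo.
    have [qI uI] := noab _ _ _ D'J (ts_ss T') P1' P2' oqu.
    by apply/mem_chords/eo.
  have ww : {in chords D, writhe D =1 writhe D'}.
    case=> q u /mem_chords oqu; have [qI uI] := noab _ _ _ DJ (ts_ss T) P1 P2 oqu.
    by apply: eq_writhe; apply: agree_off_derive ag _.
  exact: (@same_invariants_eq R (gauss_of D) (gauss_of D') (chords D) (perm_refl _) DD' ww).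
have [n1 n2 n3] := layered_not_virtual lay.
have P3' : passes D' p3 `[c, d]%classic `[e, g]%classic.
  move=> s t sI tI; rewrite -!eD ?(nI _ _ a01 sI) ?(nI _ _ a02 tI)// => E'.
  have := P3 s t sI tI E'.
  have o1 := eo _ _ (nI _ _ a01 sI) (nI _ _ a02 tI).
  have o2 := eo _ _ (nI _ _ a02 tI) (nI _ _ a01 sI).
  by case: (p3); [move/o1|move/o2|case=> ? ?; split=> [/o1|/o2]].
have abJ : `[a, b]%classic `<=` `[a, b]%classic `|` `[c, d]%classic `|` `[e, g]%classic.
  by move=> t tI; left; left.
have [C [pD pD' wC offC]] := box_chords ag abJ DJ D'J.
have [uL mL] := three_strands_chords T (closed _ DJ) n1 n2 n3 P1 P2 P3.
have [uL' mL'] := three_strands_chords T' (closed _ D'J) n1 n2 n3 P1' P2' P3'.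
have JE t : [\/ t \in `[a, b], t \in `[c, d] | t \in `[e, g]] <->
    (`[a, b]%classic `|` `[c, d]%classic `|` `[e, g]%classic) t.
  split; first by case=> ?; [left; left|left; right|right].
  by move=> [[]|] ?; [constructor 1|constructor 2|constructor 3].
apply: (layered_triangle T T' (unit_sqr K0) (unit_sqr K1) (unit_sqr K2)
  (C := C) _ _ _ wC _ _ lay).
- by move=> k /offC[k1' k2']; split; apply/negP => kI; [apply: k1'|apply: k2']; left; left.
- by move=> k /offC[k1' k2']; split; apply/negP => kI; [apply: k1'|apply: k2']; left; right.
- by move=> k /offC[k1' k2']; split; apply/negP => kI; [apply: k1'|apply: k2']; right.
- by apply: pD => // k; rewrite mL; split=> -[ok kJ]; split=> //; apply/JE.
- by apply: pD' => // k; rewrite mL'; split=> -[ok kJ]; split=> //; apply/JE.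
Qed.

(** With the moving arc on top or at the bottom, either order of the other two strands is a
    layering; their unique crossing decides which one occurs. *)
Lemma move3_layered D D' : move3 D D' -> layered_move3 D D'.
Proof.
move=> [a [b [c [d [e [g [f [h [ag DJ D'J [gm gm' [g1 g1'] [g2 g2']] [bnd fh
  [p [P P' pp]]]]]]]]]]]].
exists a, b, c, d, e, g, f, h; split=> //; split=> //.
have sub (E : diagram R) : passes E p `[a, b]%classic (`[c, d]%classic `|` `[e, g]%classic) ->
    passes E p `[a, b]%classic `[c, d]%classic /\ passes E p `[a, b]%classic `[e, g]%classic.
  by move=> H; split=> s t sI tI; apply: H => //; [left|right].
exists p, p; split; [exact: sub|exact: sub|].
have [pv|npv] := pselect (p = Virtually); [by left|right].
have {}pp : forall s t, s \in `[c, d] -> t \in `[e, g] -> D s = D t ->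
  over D (s, t) \/ over D (t, s) by case: pp.
have bf x : x \in `[-1, 1] -> `|f x| < 1 /\ `|'D_1 f x| < 1 by move=> /bnd[].
have [k0 [k1 [k2 [_ _ _ _ [s1 [s2 [t1 [t2 [u1 [u2 T]]]]]]]]]] :=
  three_strands_exist gm g1 g2 bf.
have only := ts_tu_only T.
case: (pp t2 u2 (ts_t2 T) (ts_u2 T) (ts_tu T)) => otu.
  exists Above; split; last by case: p npv {P P' sub pp}.
  by move=> s t sI tI E'; have [-> ->] := only _ _ sI tI E'.
exists Below; split; last by case: p npv {P P' sub pp}.
by move=> s t sI tI E'; have [-> ->] := only _ _ sI tI E'.
Qed.

End Move3.

(** * Planar isotopies *)

Section Reparametrization.
Variables (R : realType) (D D' : diagram R) (H : R * (R * R) -> R * R) (sigma : R -> R).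
Hypotheses (isoH : ambient_isotopy H) (ssigma : smooth sigma).
Hypotheses (sigma_incr : forall t, 0 < 'D_1 sigma t).
Hypotheses (D'E : forall t, D' t = H (1, D (sigma t))).

Let smoothH : smooth H. Proof. by case: isoH. Qed.

Lemma reparam_order : order_embedding sigma.
Proof.
have ds t : derivable sigma t 1 by exact: smooth_derivable.
have lt_sigma : {homo sigma : x y / x < y}.
  move=> x y xy; have [||z _ e] := @MVT R sigma (fun x => 'D_1 sigma x) x y xy.
  - by move=> z _; exact/derivableP.
  - exact/continuous_subspaceT/smooth_continuous.
  by rewrite -subr_gt0 e mulr_gt0// subr_gt0.
by move=> x y; apply: sgz_lt; rewrite (leW_mono (le_mono lt_sigma)).
Qed.

Lemma reparam_id_at_infinity : exists N : R, forall t, N <= `|t| -> sigma t = t.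
Proof.
have [_ _ [r Hr] [G [_ GH]]] := isoH.
have [M DM] := curve_long D; have [M' DM'] := curve_long D'.
have [rad1 std strip] := radiusP D; set q := radius D in rad1 std strip.
have ct : {within `[- q, q], continuous (fun t => `|D t|)}.
  apply: continuous_subspaceT => t.
  apply: (@continuous_comp _ _ _ (D : R -> R * R) (fun x => `|x|) t);
    [exact: curve_continuous|exact: norm_continuous].
have q0 : 0 <= q by lra.
have [|m mI mmax] := EVT_max _ ct; first lra.
(* Beyond M' the curve D' is standard, beyond r the isotopy fixes (t, 0), and beyond |D m|, the
   maximum of |D| on [-q, q], the point (t, 0) is not reached from that interval, outside which D is
   standard. *)
exists (`|r| + `|M| + `|M'| + `|q| + `|D m| + 1) => t tN.
have D't : D' t = (t, 0).
  apply: DM'; apply: le_trans tN; apply: le_trans (ler_norm _) _.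
  by have := (normr_ge0 r, normr_ge0 M, normr_ge0 q, normr_ge0 (D m)); case=> [[[? ?] ?] ?]; lra.
have Hout : H (1, D' t) = D' t.
  apply: Hr; rewrite D't prod_normE le_max /=; apply/orP; left.
  apply: le_trans tN; apply: le_trans (ler_norm r) _.
  by have := (normr_ge0 M', normr_ge0 M, normr_ge0 q, normr_ge0 (D m)); case=> [[[? ?] ?] ?]; lra.
have Dsig : D (sigma t) = (t, 0).
  by rewrite -(GH 1 (D (sigma t))).1 -D'E -{1}Hout (GH 1 (D' t)).1 D't.
have [sq|qs] := leP `|sigma t| q.
  have : `|D (sigma t)| <= `|D m| by apply: mmax; rewrite in_itv /= -ler_norml.
  rewrite Dsig prod_normE ge_max /= => /andP[tm _].
  move: tN; have := (normr_ge0 M', normr_ge0 M, normr_ge0 q, normr_ge0 r).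
  by case=> [[[? ?] ?] ?]; lra.
by move: Dsig; rewrite std; [case|lra].
Qed.

Lemma reparam_onto u : exists t, sigma t = u.
Proof.
have [N sN] := reparam_id_at_infinity.
pose b := `|N| + `|u|.
have bN : N <= `|b| by rewrite ger0_norm /b ?addr_ge0//; have := ler_norm N; have := normr_ge0 u; lra.
have cs : {within `[- b, b], continuous sigma}.
  exact/continuous_subspaceT/smooth_continuous.
have b0 : 0 <= b by rewrite addr_ge0.
have lbb : - b <= b by lra.
have [|t _ e] := @IVT R sigma (- b) b u lbb cs; last by exists t.
rewrite !sN ?normrN// ge_min le_max /b.
  have := ler_norm u; have := ler_norm (- u); rewrite normrN; have := normr_ge0 N.
  by move=> n0 u1 u2; apply/andP; split; apply/orP; [left|right]; lra.
Qed.

End Reparametrization.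

(** * The Jacobian of an ambient isotopy *)

Section Jacobian.
Variable R : realType.

Lemma derive_pair (V W : normedModType R) (f : R -> V) (g : R -> W) t :
  differentiable f t -> differentiable g t ->
  differentiable (fun x => (f x, g x)) t /\
  'D_1 (fun x => (f x, g x)) t = ('D_1 f t, 'D_1 g t).
Proof.
move=> df dg; have dfg := differentiable_pair df dg; split=> //.
by rewrite !deriveE// diff_pair.
Qed.

Lemma derive_scale (V W : normedModType R) (f : V -> W) x (c : R) v :
  differentiable f x -> 'D_(c *: v) f x = c *: 'D_v f x.
Proof. by move=> df; rewrite !deriveE// linearZ. Qed.

Lemma derive_line (V : normedModType R) (p v : V) (t : R) :
  differentiable (fun x : R => p + x *: v) t /\ 'D_1 (fun x : R => p + x *: v) t = v.
Proof.
have d1 : differentiable (fun x : R => x *: v) t.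
  by apply: (@ex_diff _ _ _ _ _ _ _ (is_diff_scalel t v)).
have d2 : differentiable (fun x : R => p + x *: v) t.
  by apply: differentiableD => //; exact: differentiable_cst.
split=> //; rewrite deriveD; [|exact: derivable_cst|exact: diff_derivable].
rewrite derive_cst add0r deriveE//.
by rewrite (@diff_val _ _ _ _ _ _ _ (is_diff_scalel t v)) scale1r.
Qed.

Lemma det2_scale (a b : R) (v w : R * R) : det2 (a *: v) (b *: w) = a * b * det2 v w.
Proof. by case: v w => [v1 v2] [w1 w2]; rewrite /det2 /= /GRing.scale /=; ring. Qed.

Lemma det2_frame (X Y v w : R * R) :
  det2 (v.1 *: X + v.2 *: Y) (w.1 *: X + w.2 *: Y) = det2 X Y * det2 v w.
Proof.
by rewrite /det2 /= /GRing.scale /=; ring.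
Qed.

Lemma det2_eq0_dependent (X Y : R * R) : det2 X Y = 0 ->
  exists a b : R, [/\ (a, b) <> 0, a * X.1 + b * Y.1 = 0 & a * X.2 + b * Y.2 = 0].
Proof.
case: X Y => [x1 x2] [y1 y2]; rewrite /det2 /= => d0.
have pair0 (a b : R) : (a, b) = 0 -> a = 0 /\ b = 0 by case.
have [[e1 e2]|ne] := pselect (y1 = 0 /\ x1 = 0).
  have [[e3 e4]|ne] := pselect (y2 = 0 /\ x2 = 0).
    exists 1, 0; rewrite e1 e2 e3 e4; split; [|by ring..].
    by move=> /pair0[/eqP]; rewrite oner_eq0.
  exists y2, (- x2); split; [|by rewrite -[RHS]d0; ring|by ring].
  by move=> /pair0[e3 /eqP]; rewrite oppr_eq0 => /eqP e4; apply: ne.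
exists y1, (- x1); split; [|by ring|].
  by move=> /pair0[e3 /eqP]; rewrite oppr_eq0 => /eqP e4; apply: ne.
by apply: oppr_inj; rewrite oppr0 -[RHS]d0; ring.
Qed.

Variables (H : R * (R * R) -> R * R).
Hypothesis isoH : ambient_isotopy H.

Definition jac (z : R * (R * R)) (v : R * R) : R * R := 'D_(0, v) H z.

Let smoothH : smooth H. Proof. by case: isoH. Qed.

Lemma jac_linear z (v : R * R) : jac z v = v.1 *: jac z (1, 0) + v.2 *: jac z (0, 1).
Proof.
have dH := smooth_differentiable z smoothH.
rewrite /jac !deriveE//.
have -> : (0, v) = v.1 *: (0, (1, 0)) + v.2 *: (0, (0, 1)) :> R * (R * R).
  apply: injective_projections; [|apply: injective_projections] => /=;
    by rewrite /GRing.scale /= ?mulr0 ?mulr1 ?addr0 ?add0r.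
by rewrite linearD !linearZ.
Qed.

Lemma jac_scale z (c : R) v : jac z (c *: v) = c *: jac z v.
Proof.
have dH := smooth_differentiable z smoothH.
rewrite /jac !deriveE//.
have -> : (0, c *: v) = c *: (0, v) :> R * (R * R).
  by apply: injective_projections => //=; rewrite scaler0.
by rewrite linearZ.
Qed.

Lemma jac_curve (g : R -> R * R) u t : differentiable g t ->
  'D_1 (fun x => H (u, g x)) t = jac (u, g t) ('D_1 g t).
Proof.
move=> dg; have [d e] := derive_pair (differentiable_cst u t) dg.
have := derive_chain (1 : R) d (smooth_differentiable _ smoothH).
by rewrite e derive_cst; exact: id.
Qed.

(** The inverse isotopy G sends the image of the line p + x v back to that line, so the chain rule
    recovers its velocity v from [jac z v]. *)
Lemma jac_inj z v : jac z v = 0 -> v = 0.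
Proof.
case: z => u p Jv; have [_ _ _ [G [sG GH]]] := isoH.
have [dl el] := derive_line p v 0.
have dHl : differentiable (fun x : R => H (u, p + x *: v)) 0.
  have [d _] := derive_pair (differentiable_cst u 0) dl.
  by apply: (differentiable_comp d); exact: smooth_differentiable.
have J0 : 'D_1 (fun x : R => H (u, p + x *: v)) 0 = 0.
  by have := jac_curve u dl; rewrite el scale0r addr0 Jv.
have [d e] := derive_pair (differentiable_cst u 0) dHl.
have := derive_chain (1 : R) d (smooth_differentiable _ sG).
have -> : G \o (fun x : R => (cst u x, H (u, p + x *: v))) = (fun x : R => p + x *: v).
  by apply/funext => x /=; rewrite (GH u _).1.
by rewrite el e J0 derive_cst => ->; exact: derive0.
Qed.

Definition jac_det z : R := det2 (jac z (1, 0)) (jac z (0, 1)).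

Lemma jac_det_neq0 z : jac_det z != 0.
Proof.
apply/eqP => /det2_eq0_dependent[a [b [ab e1 e2]]].
have /(@jac_inj z) abE : jac z (a, b) = 0 by rewrite jac_linear; exact: injective_projections.
by case: ab; exact: abE.
Qed.

(** The determinant is 1 at time 0 and never vanishes, so it stays positive by continuity in time.
    Hence an isotopy preserves writhes. *)
Lemma jac_det_gt0 p : 0 < jac_det (1, p).
Proof.
have cX v : continuous (fun u : R => jac (u, p) v).
  move=> u; apply: (@continuous_comp _ _ _ (fun u : R => (u, p)) (fun z => jac z v) u).
    apply: differentiable_continuous.
    exact: (differentiable_pair (@ex_diff _ _ _ _ _ _ _ (is_diff_id u)) (differentiable_cst p u)).
  exact: smooth_derive_continuous.
have c1 v : continuous (fun u : R => (jac (u, p) v).1).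
  by move=> u; apply: (@continuous_comp _ _ _ (fun u : R => jac (u, p) v) fst u (cX v u)); exact: cvg_fst.
have c2 v : continuous (fun u : R => (jac (u, p) v).2).
  by move=> u; apply: (@continuous_comp _ _ _ (fun u : R => jac (u, p) v) snd u (cX v u)); exact: cvg_snd.
have cdet : continuous (fun u : R => jac_det (u, p)).
  by move=> u; apply: cvgB; apply: cvgM; [exact: c1|exact: c2|exact: c2|exact: c1].
have [_ H0 _ _] := isoH.
have jac0 v : jac (0, p) v = v.
  have [dl el] := derive_line p v 0.
  have := jac_curve 0 dl; rewrite el scale0r addr0 => <-.
  have -> : (fun x : R => H (0, p + x *: v)) = (fun x : R => p + x *: v).
    by apply/funext => x; rewrite H0.
  by [].
have det0 : jac_det (0, p) = 1 by rewrite /jac_det !jac0 /det2 /=; ring.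
rewrite ltNge; apply/negP => le0.
have [||u _ e] := @IVT R (fun u => jac_det (u, p)) 0 1 0 ler01.
- exact: continuous_subspaceT.
- by rewrite det0 ge_min le_max le0 ler01 orbT.
by have := jac_det_neq0 (u, p); rewrite e eqxx.
Qed.

End Jacobian.

Lemma isotopy_invariants (R : realType) (D D' : diagram R) : planar_isotopic D D' ->
  same_invariants (gauss_of D) (gauss_of D').
Proof.
move=> [H [sigma [isoH [ssigma sigma_incr] D'E oE]]].
have os := reparam_order ssigma sigma_incr.
have inj_sigma : injective sigma.
  move=> x y e; apply/eqP; rewrite -subr_eq0 -sgz_eq0 -os e subrr sgz0 eqxx//.
apply: (@gauss_relabel R (gauss_of D) (gauss_of D') sigma os).
  apply: chords_perm.
    rewrite map_inj_uniq ?chords_uniq// => -[a b] [c d] [/inj_sigma -> /inj_sigma ->] //.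
  case=> q u; split=> [/mapP[[s t] /mem_chords /oE ost [-> ->]] //|oqu].
  have [s sq] := reparam_onto isoH ssigma D'E q.
  have [t tu] := reparam_onto isoH ssigma D'E u.
  apply/mapP; exists (s, t); last by rewrite /relabel /= sq tu.
  by apply/mem_chords/oE; rewrite sq tu.
have d' t : 'D_1 D' t = 'D_1 sigma t *: jac H (1, D (sigma t)) ('D_1 D (sigma t)).
  have ds : differentiable sigma t by exact: smooth_differentiable.
  have dDs : differentiable (D \o sigma) t.
    by apply: differentiable_comp => //; exact: curve_differentiable.
  have e1 := jac_curve isoH 1 dDs.
  have e2 := derive_chain (1 : R) ds (curve_differentiable D (sigma t)).
  have e3 : 'D_('D_1 sigma t) D (sigma t) = 'D_1 sigma t *: 'D_1 D (sigma t).
    rewrite -(derive_scale ('D_1 sigma t) (1 : R) (curve_differentiable D (sigma t))).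
    by congr ('D_ _ _ _); rewrite [RHS]mulr1.
  rewrite e2 e3 (jac_scale isoH) in e1; rewrite -e1.
  by congr ('D_1 _ t); apply/funext => x; exact: D'E.
case=> s t /mem_chords /oE ost; have [_ e] := over_double ost.
rewrite /= /writhe /=; rewrite !d' e.
set v := 'D_1 D (sigma s); set w := 'D_1 D (sigma t).
have pos : 0 < 'D_1 sigma s * 'D_1 sigma t * jac_det H (1, D (sigma t)).
  by apply: mulr_gt0; [exact: mulr_gt0|exact: jac_det_gt0].
rewrite det2_scale (jac_linear isoH _ v) (jac_linear isoH _ w) det2_frame mulrA sgzM.
by rewrite (gtr0_sgz pos) mul1r.
Qed.

(** * Crossing changes and the commutation theorem *)

Section EarlyOver.
Variable R : realType.
Implicit Types D : diagram R.

Lemma EO_overE D q u : over (diagram_EO D) (q, u) <->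
  q < u /\ (over D (q, u) \/ over D (u, q)).
Proof.
split=> [[[/= ov lt]|[/= ov]]|[lt [ov|ov]]].
- by split; [exact: lt|left].
- rewrite /is_EO /= -leNgt le_eqVlt => /orP[/eqP e|lt]; last by split; [|right].
  by have [/eqP] := over_double ov; rewrite e.
- by left.
- by right; split=> //; rewrite /is_EO /= -leNgt ltW.
Qed.

Lemma EO_agree_off D D' a b : agree_off D D' a b ->
  agree_off (diagram_EO D) (diagram_EO D') a b.
Proof.
move=> [ab eD eo]; split=> // q u qI uI.
have e1 := eo q u qI uI; have e2 := eo u q uI qI.
split=> /EO_overE[qu [ov|ov]]; apply/EO_overE; split=> //.
- by left; apply/e1.
- by right; apply/e2.
- by left; apply/e1.
- by right; apply/e2.
Qed.

Lemma EO_isotopic D D' : planar_isotopic D D' ->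
  planar_isotopic (diagram_EO D) (diagram_EO D').
Proof.
move=> [H [sigma [isoH [ss si] D'E oE]]]; exists H, sigma; split=> // q u.
have lt_sigma : (sigma q < sigma u) = (q < u).
  by rewrite -subr_lt0 -sgz_lt0 (reparam_order ss si) sgz_lt0 subr_lt0.
have e1 := oE q u; have e2 := oE u q.
split=> /EO_overE[qu [ov|ov]]; apply/EO_overE; move: qu; rewrite lt_sigma => qu; split=> //.
- by left; apply/e1.
- by right; apply/e2.
- by left; apply/e1.
- by right; apply/e2.
Qed.

Definition EO_passage (p : passage) (before : bool) : passage :=
  if p is Virtually then Virtually else if before then Above else Below.

(** Of two disjoint intervals one entirely precedes the other, so all classical crossings of the two
    strands become EO with the same strand on top. *)
Lemma EO_passes D p a b c d : a <= b -> c <= d -> apart `[a, b] `[c, d] ->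
  passes D p `[a, b]%classic `[c, d]%classic ->
  passes (diagram_EO D) (EO_passage p (a < c)) `[a, b]%classic `[c, d]%classic.
Proof.
move=> ab cd sep P s t sI tI e.
have aI : a \in `[a, b] by rewrite in_itv /= lexx.
have cI : c \in `[c, d] by rewrite in_itv /= lexx.
have st : (s < t) = (a < c).
  by rewrite -subr_lt0 -sgz_lt0 (sgz_apart sep sI aI tI cI) sgz_lt0 subr_lt0.
have ts : (t < s) = (c < a).
  by rewrite -subr_gt0 -sgz_gt0 (sgz_apart sep sI aI tI cI) sgz_gt0 subr_gt0.
have ac : a != c by apply/eqP => ac; have := sep a aI; rewrite ac cI.
have := P s t sI tI e; case: p {P} => /=.
- move=> ov; case: ifP => h; apply/EO_overE; [by rewrite st; split; [|left]|].
  by rewrite ts lt_neqAle eq_sym ac leNgt h; split; [|right].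
- move=> ov; case: ifP => h; apply/EO_overE; [by rewrite st; split; [|right]|].
  by rewrite ts lt_neqAle eq_sym ac leNgt h; split; [|left].
- by move=> [n1 n2]; split=> /EO_overE[_ []].
Qed.

Lemma EO_move1 D D' : move1 D D' -> move1 (diagram_EO D) (diagram_EO D').
Proof.
by move=> [a [b [ag DJ D'J inj only]]]; exists a, b; split=> //; exact: EO_agree_off.
Qed.

Lemma EO_move2 D D' : move2 D D' -> move2 (diagram_EO D) (diagram_EO D').
Proof.
move=> [a [b [c [d [f [h [ag DJ D'J [gm gm' gf gf'] [bnd zeros [p P]]]]]]]]].
exists a, b, c, d, f, h; split=> //; first exact: EO_agree_off.
split=> //; exists (EO_passage p (a < c)).
have fpos x : x = 1 \/ x = -1 -> f x != 0.
  move=> x1; have [|/andP[/gt_eqF -> _] //] := bnd x.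
  by case: x1 => ->; rewrite in_itv /=; lra.
apply: EO_passes P.
- by case: gm => /ltW.
- by case: gf => /ltW.
- by apply: strands_apart gm gf _ _; apply: fpos; [left|right].
Qed.

Lemma EO_layered (p1 p2 p3 : passage) (x y z : R) : layered p1 p2 p3 ->
  layered (EO_passage p1 (x < y)) (EO_passage p2 (x < z)) (EO_passage p3 (y < z)).
Proof.
move=> /layered_not_virtual[n1 n2 n3].
case: p1 n1 => // _; case: p2 n2 => // _; case: p3 n3 => // _; rewrite /EO_passage;
by case: (ltP x y); case: (ltP x z); case: (ltP y z) => //=; lra.
Qed.

Lemma EO_layered_move3 D D' : layered_move3 D D' ->
  layered_move3 (diagram_EO D) (diagram_EO D').
Proof.
move=> [a [b [c [d [e [g [f [h [ag DJ D'J [gm gm' [g1 g1'] [g2 g2']] [bnd fh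
  [p1 [p2 [[P1 P2] [P1' P2'] pp]]]]]]]]]]]]].
exists a, b, c, d, e, g, f, h; split=> //; first exact: EO_agree_off.
split=> //; exists (EO_passage p1 (a < c)), (EO_passage p2 (a < e)).
have bf x : x \in `[-1, 1] -> `|f x| < 1 /\ `|'D_1 f x| < 1 by move=> /bnd[].
have [k0 [k1 [k2 [_ _ _ _ [s1 [s2 [t1 [t2 [u1 [u2 T]]]]]]]]]] :=
  three_strands_exist gm g1 g2 bf.
have [T01 T02 T12] : [/\ apart `[a, b] `[c, d], apart `[a, b] `[e, g]
  & apart `[c, d] `[e, g]] by case: T.
have ab : a <= b by case: gm => /ltW.
have cd : c <= d by case: g1 => /ltW.
have eg : e <= g by case: g2 => /ltW.
split; [by split; exact: EO_passes|by split; exact: EO_passes|].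
case: pp => [[-> ->]|[p3 [P3 lay]]]; [by left|right].
exists (EO_passage p3 (c < e)); split; [exact: EO_passes|exact: EO_layered].
Qed.

End EarlyOver.

(** * Invariance under equivalence of diagrams *)

Section Invariance.
Variable R : realType.
Implicit Types D : diagram R.

Lemma elementary_move_invariants D D' : elementary_move D D' ->
  same_invariants (gauss_of D) (gauss_of D') /\
  same_invariants (gauss_of (diagram_EO D)) (gauss_of (diagram_EO D')).
Proof.
case=> m; split.
- exact: isotopy_invariants.
- exact/isotopy_invariants/EO_isotopic.
- exact: move1_invariants.
- exact/move1_invariants/EO_move1.
- exact: move2_invariants.
- exact/move2_invariants/EO_move2.
- exact/layered_move3_invariants/move3_layered.
- exact/layered_move3_invariants/EO_layered_move3/move3_layered.
Qed.

Lemma equivalent_invariants D D' : equivalent D D' ->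
  same_invariants (gauss_of D) (gauss_of D') /\
  same_invariants (gauss_of (diagram_EO D)) (gauss_of (diagram_EO D')).
Proof.
elim=> {D D'} [D D'|D|D D' _ [IH IHE]|D D' D'' _ [IH1 IH1E] _ [IH2 IH2E]].
- exact: elementary_move_invariants.
- by split=> F x x0.
- split=> F x x0; first by have [-> ->] := IH F x x0.
  by have [-> ->] := IHE F x x0.
- split=> F x x0.
    by have [-> ->] := IH1 F x x0; have [-> ->] := IH2 F x x0.
  by have [-> ->] := IH1E F x x0; have [-> ->] := IH2E F x x0.
Qed.

Lemma equivalent_W D D' (F : fieldType) (x : F) : equivalent D D' -> x != 0 ->
  diagram_W D x = diagram_W D' x.
Proof.
move=> /equivalent_invariants[H _] x0; rewrite !diagram_W_gauss.
by have [] := H F x x0.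
Qed.

Lemma knot_of_eq D D' : knot_of D = knot_of D' <-> equivalent D D'.
Proof.
split=> [/eqmodP/asboolP //|DD']; apply/eqmodP/asboolP; exact: DD'.
Qed.

Lemma diagram_of_knot_of D : equivalent (diagram_of (knot_of D)) D.
Proof. by apply/knot_of_eq; rewrite /knot_of /diagram_of reprK. Qed.

End Invariance.

Lemma juxtaposition_commute (R : realType) (E E' D1 D2 : diagram R) (F : fieldType) (x : F) :
  (4 : F) != 0 -> x != 0 -> juxtaposition E D1 D2 -> juxtaposition E' D2 D1 ->
  same_invariants (gauss_of E) (gauss_of E') ->
  diagram_W D1 x * diagram_W D2 x^-1 = diagram_W D1 x^-1 * diagram_W D2 x.
Proof.
move=> n4 x0 J J' H; have [_] := H F x x0.
rewrite (juxtaposition_form x J) (juxtaposition_form x J').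
move: (gauss_form x (gauss_of D1)) (gauss_form x (gauss_of D2)) => f1 f2.
move: (diagram_W D1 x) (diagram_W D1 x^-1) (diagram_W D2 x) (diagram_W D2 x^-1).
(* The forms of D1 and D2 cancel between the two products; what remains is 2 (ad - bc) = 2 (cb -
   da), that is 4 (ad - bc) = 0. *)
move=> a b c d e; apply/eqP; rewrite -subr_eq0 -(mulrI_eq0 _ (mulfI n4)).
apply/eqP; transitivity ((f1 + f2 + 2 * (a * d - b * c)) - (f2 + f1 + 2 * (c * b - d * a))).
  by ring.
by rewrite e subrr.
Qed.

Lemma s_var_neq0 : s_var != 0.
Proof. by rewrite /s_var tofrac_eq0 polyX_eq0. Qed.

Lemma four_neq0 : (4 : {fraction {poly int}}) != 0.
Proof.
have -> : (4 : {fraction {poly int}}) = tofrac (4%:R%:P) by rewrite !rmorph_nat.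
by rewrite tofrac_eq0 polyC_eq0.
Qed.

Theorem theorem5p1 (R : realType) (K1 K2 : long_virtual_knot R) :
  knot_product K1 K2 = knot_product K2 K1 ->
  W K1 s_var * W K2 s_var^-1 = W K1 s_var^-1 * W K2 s_var /\
  W (EO K1) s_var * W (EO K2) s_var^-1 = W (EO K1) s_var^-1 * W (EO K2) s_var.
Proof.
move=> /knot_of_eq/equivalent_invariants[H HE].
have s0 := s_var_neq0.
have si0 : s_var^-1 != 0 by rewrite invr_eq0.
split.
  exact: (juxtaposition_commute four_neq0 s0 (product_juxtaposition _ _)
    (product_juxtaposition _ _) H).
(* W of [EO K] is computed on an arbitrary representative; invariance brings it back to the crossing
   change of the diagram chosen for K. *)
have WE (K : long_virtual_knot R) y : y != 0 -> W (EO K) y = diagram_W (diagram_EO (diagram_of K)) y :> {fraction {poly int}}.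
  by move=> y0; exact: equivalent_W (diagram_of_knot_of (diagram_EO (diagram_of K))) y0.
rewrite (WE K1 _ s0) (WE K2 _ si0) (WE K1 _ si0) (WE K2 _ s0).
exact: (juxtaposition_commute four_neq0 s0 (product_EO_juxtaposition _ _)
  (product_EO_juxtaposition _ _) HE).
Qed.
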